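(* Let $i\in I$, $k\in\mathbb{Z}$, and let $x\in\widehat{\mathcal{A}}_{>k+1}$, $y\in\widehat{\mathcal{A}}_{[k+1]}$, $z\in\widehat{\mathcal{A}}_{[k]}$, $w\in\widehat{\mathcal{A}}_{<k}$ be homogeneous elements. Then \begin{enumerate} \item[(i)] $f_{i,k}(xyzw)=q_i^{(-1)^k\langle h_i,\mathrm{wt}(xy)\rangle-1}\big((q_i^{-1}-q_i)x(e_i^\star(y))zw+q_ixy(f_{i,k}z)w\big)$, \item[(ii)] $E'_{i,k}(xyzw)=q_i^{(-1)^k\langle h_i,\mathrm{wt}(xy)\rangle}\big((q_i^{-1}-q_i)xy(e'_i(z))w+q_ix(yf_{i,k+1})zw\big)$, \item[(iii)] $(xyzw)f_{i,k+1}=q_i^{(-1)^{k+1}\langle h_i,\mathrm{wt}(zw)\rangle-1}\big((q_i^{-1}-q_i)xy(e'_i(z))w+q_ix(yf_{i,k+1})zw\big)$, \item[(iv)] $E^\star_{i,k+1}(xyzw)=q_i^{(-1)^{k+1}\langle h_i,\mathrm{wt}(zw)\rangle}\big((q_i^{-1}-q_i)x(e_i^\star(y))zw+q_ixy(f_{i,k}z)w\big)$. \end{enumerate}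
   Context: Let $\mathsf{C}=(c_{i,j})_{i,j\in I}$ be a finite-type Cartan matrix with simple roots $\alpha_i$, coroots $h_i$, $(\alpha_i,\alpha_j)=\mathsf{d}_ic_{i,j}$ ($\min\mathsf{d}_i=1$), $q_i=q^{\mathsf{d}_i}$, $\mathbf{k}=\mathbb{Q}(q^{1/2})$. $\widehat{\mathcal{A}}$ is the bosonic extension generated by $f_{i,p}$ ($i\in I,p\in\mathbb{Z}$) with quantum Serre relations among $\{f_{i,p}\}_{i\in I}$ for fixed $p$, $f_{i,m}f_{j,p}=q_i^{(-1)^{p-m+1}c_{i,j}}f_{j,p}f_{i,m}$ ($p>m+1$), $f_{i,p}f_{j,p+1}=q_i^{c_{i,j}}f_{j,p+1}f_{i,p}+\delta_{i,j}(1-q_i^2)$, weights $\mathrm{wt}(f_{i,p})=(-1)^{p+1}\alpha_i$. For an interval $J$, $\widehat{\mathcal{A}}_J$ is the subalgebra generated by $f_{i,p}$, $p\in J$ (e.g. $\widehat{\mathcal{A}}_{>k+1}$, $\widehat{\mathcal{A}}_{<k}$); $\widehat{\mathcal{A}}_{[k]}\cong\mathcal{U}_q^-(\mathfrak{g})$ via $f_{i,k}\mapsto f_i$. $e'_i,e^\star_i$ are the $q$-derivations of $\mathcal{U}_q^-(\mathfrak{g})$ with $e'_i(f_j)=e^\star_i(f_j)=\delta_{i,j}$, $e'_i(uv)=e'_i(u)v+q_i^{\langle h_i,\mathrm{wt}(u)\rangle}ue'_i(v)$, $e^\star_i(uv)=ue^\star_i(v)+q_i^{\langle h_i,\mathrm{wt}(v)\rangle}e^\star_i(u)v$,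 acting on each $\widehat{\mathcal{A}}_{[k]}$ via this identification. $(\!(\cdot,\cdot)\!)$ is the bilinear form on $\widehat{\mathcal{A}}$: for homogeneous $u=u_b\cdots u_a$, $v=v_b\cdots v_a$ with $u_k,v_k$ weight vectors of $\widehat{\mathcal{A}}_{[k]}$, $(\!(u,v)\!)=\prod_k\kappa^{|\mathrm{wt}(u_k)|+|\mathrm{wt}(v_k)|}(u_k,v_k)_L$, where $(\cdot,\cdot)_L$ is Lusztig's form ($(f_i,f_j)_L=\delta_{i,j}/(1-q_i^2)$), $\kappa_i=q_i^{1/2}(q_i^{-1}-q_i)$, $\kappa^{\sum n_i\alpha_i}=\prod\kappa_i^{n_i}$, $|\sum n_i\alpha_i|=\sum|n_i|\alpha_i$; it is symmetric and non-degenerate. $E'_{i,k}$ and $E^\star_{i,k}$ are the $\mathbf{k}$-linear maps on $\widehat{\mathcal{A}}$ defined by $(\!(E'_{i,k}(u),v)\!)=(\!(u,f_{i,k}v)\!)$ and $(\!(E^\star_{i,k}(u),v)\!)=(\!(u,vf_{i,k})\!)$ for all $u,v$. *)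

(* Defs.v *)
(* Bosonic extension \hat A of U_q^-(g) over k = Q(q^{1/2}),
   presented by generators and relations; elements are represented by
   (unnormalised) noncommutative polynomials, equality in \hat A is
   congruence modulo the two-sided ideal of relations. *)
From HB Require Import structures.
From mathcomp Require Import all_boot all_order all_algebra fraction.
Set Implicit Arguments. Unset Strict Implicit. Unset Printing Implicit Defensive.
Import Order.TTheory GRing.Theory Num.Theory.
Local Open Scope ring_scope.

(* the base field k = Q(q^{1/2}); qh = q^{1/2} is the indeterminate *)
Notation kf := {fraction {poly rat}}.
Definition qh : kf := FracField.tofrac ('X : {poly rat}).
Definition qq : kf := qh ^+ 2.

Section Free.
Variable X : eqType.
Definition fpoly := seq (kf * seq X).
Definition fcoef (p : fpoly) (w : seq X) : kf := \sum_(cw <- p | cw.2 == w) cw.1.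
Definition fadd (p q : fpoly) : fpoly := p ++ q.
Definition fscale (c : kf) (p : fpoly) : fpoly := [seq (c * cw.1, cw.2) | cw <- p].
Definition fsub (p q : fpoly) : fpoly := fadd p (fscale (-1) q).
Definition fmul (p q : fpoly) : fpoly := [seq (a.1 * b.1, a.2 ++ b.2) | a <- p, b <- q].
Definition fconst (c : kf) : fpoly := [:: (c, [::])].
Definition fone : fpoly := fconst 1.
Definition fgen (x : X) : fpoly := [:: (1, [:: x])].

Inductive in_ideal (R : fpoly -> Prop) : fpoly -> Prop :=
| ideal_nil : in_ideal R [::]
| ideal_rel r : R r -> in_ideal R r
| ideal_add p q : in_ideal R p -> in_ideal R q -> in_ideal R (fadd p q)
| ideal_mul a p b : in_ideal R p -> in_ideal R (fmul a (fmul p b))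
| ideal_ext p q : (forall w, fcoef p w = fcoef q w) -> in_ideal R p -> in_ideal R q.

Definition fcongr (R : fpoly -> Prop) (p q : fpoly) : Prop := in_ideal R (fsub p q).
End Free.

Section Cartan.
Variables (n : nat) (C : 'M[int]_n) (d : 'I_n -> nat).

Definition finite_cartan : Prop :=
  [/\ (forall i, C i i = 2),
      (forall i j, i != j -> C i j <= 0),
      ((forall i, (0 < d i)%N) /\ (exists i, d i = 1%N)),
      (forall i j, (d i)%:Z * C i j = (d j)%:Z * C j i)
    & (forall v : 'I_n -> rat, (exists i, v i != 0) ->
        0 < \sum_(i < n) \sum_(j < n) v i * ((d i)%:Z * C i j)%:~R * v j)].

Definition qi (i : 'I_n) (e : int) : kf := qq ^ ((d i)%:Z * e).

Definition qnum (x : kf) (m : nat) : kf := (x ^+ m - x ^- m) / (x - x^-1).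
Definition qfact (x : kf) (m : nat) : kf := \prod_(1 <= l < m.+1) qnum x l.
Definition qbinom (x : kf) (m r : nat) : kf := qfact x m / (qfact x r * qfact x (m - r)).

Definition serre (X : eqType) (g : 'I_n -> X) (i j : 'I_n) : fpoly X :=
  let N := absz (1 - C i j) in
  [seq ((-1) ^+ r * qbinom (qq ^+ d i) N r, nseq (N - r) (g i) ++ g j :: nseq r (g i))
  | r <- iota 0 N.+1].

(* generators f_{i,p} of \hat A *)
Definition GA : eqType := ('I_n * int)%type.

Inductive relA : fpoly GA -> Prop :=
| relA_serre (p : int) (i j : 'I_n) : i != j -> relA (serre (fun l => (l, p) : GA) i j)
| relA_far (i j : 'I_n) (m p : int) : m + 1 < p ->
    relA (fsub (fmul (fgen ((i, m) : GA)) (fgen ((j, p) : GA)))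
               (fscale (qi i ((-1) ^+ absz (p - m + 1) * C i j))
                       (fmul (fgen ((j, p) : GA)) (fgen ((i, m) : GA)))))
| relA_adj (i j : 'I_n) (p : int) :
    relA (fsub (fmul (fgen ((i, p) : GA)) (fgen ((j, p + 1) : GA)))
               (fadd (fscale (qi i (C i j)) (fmul (fgen ((j, p + 1) : GA)) (fgen ((i, p) : GA))))
                     (@fconst GA ((i == j)%:R * (1 - qi i 2))))).

Definition Aeq (p q : fpoly GA) : Prop := fcongr relA p q.

(* weights: wt(f_{i,p}) = (-1)^{p+1} alpha_i, as coordinate vectors *)
Definition wtA (g : GA) (j : 'I_n) : int := if g.1 == j then (-1) ^+ absz (g.2 + 1) else 0.
Definition wtwA (w : seq GA) (j : 'I_n) : int := \sum_(g <- w) wtA g j.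
Definition homogA (p : fpoly GA) (beta : 'I_n -> int) : Prop :=
  forall w, fcoef p w != 0 -> forall j, wtwA w j = beta j.
Definition pairh (i : 'I_n) (beta : 'I_n -> int) : int := \sum_(j < n) beta j * C i j.

(* the embedding U_q^-(g) -> \hat A_[p], f_j |-> f_{j,p} (on the free algebra) *)
Definition emb (p : int) (U : fpoly 'I_n) : fpoly GA :=
  [seq (cw.1, [seq ((l, p) : GA) | l <- cw.2]) | cw <- U].

(* q-derivations e'_i, e*_i on words (wt(f_j) = -alpha_j in U_q^-) *)
Fixpoint eprime_w (i : 'I_n) (w : seq 'I_n) : fpoly 'I_n :=
  match w with
  | [::] => [::]
  | j :: w' => fadd (if j == i then [:: (1, w')] else [::])
                    (fscale (qi i (- C i j)) (fmul (fgen j) (eprime_w i w')))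
  end.
Fixpoint estar_w (i : 'I_n) (w : seq 'I_n) : fpoly 'I_n :=
  match w with
  | [::] => [::]
  | j :: w' => fadd (fmul (fgen j) (estar_w i w'))
                    (if j == i then [:: (qi i (- \sum_(l <- w') C i l), w')] else [::])
  end.
Definition eprime (i : 'I_n) (U : fpoly 'I_n) : fpoly 'I_n :=
  flatten [seq fscale cw.1 (eprime_w i cw.2) | cw <- U].
Definition estar (i : 'I_n) (U : fpoly 'I_n) : fpoly 'I_n :=
  flatten [seq fscale cw.1 (estar_w i cw.2) | cw <- U].

(* Lusztig's form: (1,V) = constant term, (f_j u, V) = (f_j,f_j)(u, e'_j V),
   (f_j,f_j) = 1/(1-q_j^2) *)
Fixpoint lusz_w (w : seq 'I_n) (V : fpoly 'I_n) : kf :=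
  match w with
  | [::] => fcoef V [::]
  | j :: w' => (1 - qi j 2)^-1 * lusz_w w' (eprime j V)
  end.
Definition lusztig (U V : fpoly 'I_n) : kf := \sum_(cw <- U) cw.1 * lusz_w cw.2 V.

Definition kappa (j : 'I_n) : kf := qh ^+ d j * (qi j (-1) - qi j 1).
Definition kapw (w : seq 'I_n) : kf := \prod_(l <- w) kappa l.
Definition kscale (U : fpoly 'I_n) : fpoly 'I_n := [seq (cw.1 * kapw cw.2, cw.2) | cw <- U].
Definition formL (U V : fpoly 'I_n) : kf := lusztig (kscale U) (kscale V).

(* factored terms u_b ... u_a : (a, [u_a; u_{a+1}; ...; u_b]), u_k in \hat A_[k] *)
Definition fterm := (int * seq (fpoly 'I_n))%type.
Fixpoint evalT (a : int) (s : seq (fpoly 'I_n)) : fpoly GA :=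
  match s with
  | [::] => @fone _
  | U :: s' => fmul (evalT (a + 1) s') (emb a U)
  end.
Definition evalFE (F : seq fterm) : fpoly GA := flatten [seq evalT t.1 t.2 | t <- F].
Definition comp (t : fterm) (k : int) : fpoly 'I_n :=
  if (t.1 <= k) && (k < t.1 + (size t.2)%:Z) then nth (@fone _) t.2 (absz (k - t.1))
  else @fone _.
Definition formT (t u : fterm) : kf :=
  let lo := Num.min t.1 u.1 in
  let hi := Num.max (t.1 + (size t.2)%:Z) (u.1 + (size u.2)%:Z) in
  \prod_(m < absz (hi - lo)) formL (comp t (lo + m%:Z)) (comp u (lo + m%:Z)).
Definition formFE (F G : seq fterm) : kf := \sum_(t <- F) \sum_(u <- G) formT t u.

End Cartan.

(* Main.v *)
Require Import Defs.
From HB Require Import structures.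
From mathcomp Require Import all_boot all_order all_algebra fraction.
From mathcomp Require Import ring zify.

(* (i) and (iii) are straightening computations: moving f_{i,k} to the right
   through xy, only the letters of slot k+1 produce correction terms, and these
   terms add up to the skew derivation e*_i; likewise for (iii) with e'_i.

   For (ii) and (iv) the form must first be shown to be well defined on \hat A.
   Formula (i) read as a definition gives operators L_a (a a generator) on the
   free algebra M on all generators, and formula (ii) gives operators E_a.  On M
   there is Lusztig's form of the disjoint union, over the slots, of copies of
   the given Cartan datum; L_a and E_a are adjoint for it, and
   E_a L_b = lam(a,b) L_b E_a.  The E_a generate M from 1, so a relation r of
   \hat A acts through L into the radical as soon as r.1 is in the radical; this
   is immediate except for the Serre relations, where it is the vanishing of all
   skew derivatives of the Serre element.  Hence (p, q) |-> (p.1, q.1) is a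
   well-defined form on \hat A, equal to (( , )) on factored elements, and
   E_a (p.1) is a multiple of (p f_{i,k+1}).1, which turns (ii) and (iv) into
   (iii) and (i). *)

Set Implicit Arguments. Unset Strict Implicit. Unset Printing Implicit Defensive.
Import Order.TTheory GRing.Theory Num.Theory.
Local Open Scope ring_scope.

(** * Polynomials tested against functionals *)

Section Evaluation.
Variable X : eqType.
Implicit Types (p q : fpoly X) (phi psi : seq X -> kf) (w u : seq X).

(* As coefficient lists are not normalised, polynomials are compared through
   their values on all functionals [phi]; see [ev_ext]. *)
Definition ev phi p : kf := \sum_(cw <- p) cw.1 * phi cw.2.

Lemma ev_nil phi : ev phi [::] = 0.
Proof. by rewrite /ev big_nil. Qed.

Lemma ev_cons phi c w p : ev phi ((c, w) :: p) = c * phi w + ev phi p.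
Proof. by rewrite /ev big_cons. Qed.

Lemma ev_word phi c w : ev phi [:: (c, w)] = c * phi w.
Proof. by rewrite ev_cons ev_nil addr0. Qed.

Lemma ev_add phi p q : ev phi (fadd p q) = ev phi p + ev phi q.
Proof. by rewrite /ev big_cat. Qed.

Lemma ev_scale phi c p : ev phi (fscale c p) = c * ev phi p.
Proof.
rewrite /ev big_map mulr_sumr; apply: eq_bigr => cw _ /=.
by rewrite mulrA.
Qed.

Lemma ev_sub phi p q : ev phi (fsub p q) = ev phi p - ev phi q.
Proof. by rewrite ev_add ev_scale mulN1r. Qed.

Lemma ev_const phi c : ev phi (fconst X c) = c * phi [::].
Proof. exact: ev_word. Qed.

Lemma ev_one phi : ev phi (@fone X) = phi [::].
Proof. by rewrite ev_const mul1r. Qed.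

Lemma ev_gen phi x : ev phi (fgen x) = phi [:: x].
Proof. by rewrite ev_word mul1r. Qed.

Lemma eq_ev phi psi p : phi =1 psi -> ev phi p = ev psi p.
Proof. by move=> e; apply: eq_bigr => cw _; rewrite e. Qed.

Lemma eq_ev_in phi psi p :
  (forall cw, cw \in p -> cw.1 != 0 -> phi cw.2 = psi cw.2) -> ev phi p = ev psi p.
Proof.
move=> e; rewrite /ev !big_seq; apply: eq_bigr => cw /e.
by have [->|_ ->] := eqVneq cw.1 0; rewrite ?mul0r.
Qed.

Lemma ev_Zl c phi p : ev (fun w => c * phi w) p = c * ev phi p.
Proof. by rewrite /ev mulr_sumr; apply: eq_bigr => cw _; rewrite mulrCA. Qed.

Lemma ev_Dl phi psi p : ev (fun w => phi w + psi w) p = ev phi p + ev psi p.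
Proof. by rewrite /ev -big_split; apply: eq_bigr => cw _; rewrite mulrDr. Qed.

Lemma ev_0l p : ev (fun=> 0) p = 0.
Proof. by rewrite /ev big1 // => cw _; rewrite mulr0. Qed.

Lemma ev_mul phi p q :
  ev phi (fmul p q) = ev (fun w => ev (fun u => phi (w ++ u)) q) p.
Proof.
rewrite /ev /fmul big_allpairs_dep /=; apply: eq_bigr => a _.
by rewrite mulr_sumr; apply: eq_bigr => b _; rewrite mulrA.
Qed.

Lemma fcoefE p w : fcoef p w = ev (fun u => (u == w)%:R) p.
Proof.
rewrite /fcoef /ev big_mkcond; apply: eq_bigr => cw _.
by case: eqP => _; rewrite ?mulr1 ?mulr0.
Qed.

Lemma ev_fcoef phi p (s : seq (seq X)) :
  uniq s -> {subset [seq cw.2 | cw <- p] <= s} ->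
  ev phi p = \sum_(w <- s) fcoef p w * phi w.
Proof.
move=> us; elim: p => [|[c w] p ih] sub.
  by rewrite ev_nil big1 // => w _; rewrite /fcoef big_nil mul0r.
have ws : w \in s by apply: sub; rewrite inE eqxx.
rewrite ev_cons ih; last by move=> u hu; apply: sub; rewrite inE hu orbT.
transitivity (\sum_(v <- s) ((if v == w then c * phi w else 0) + fcoef p v * phi v)).
  rewrite big_split /=; congr (_ + _).
  by rewrite -big_mkcond -big_filter filter_pred1_uniq // big_seq1.
apply: eq_bigr => v _; rewrite /fcoef big_cons /= [w == v]eq_sym.
by case: eqP => [->|_]; rewrite ?add0r // mulrDl.
Qed.

(** Collecting equal words writes [ev phi p] as a sum of [fcoef p w * phi w], so only the
    coefficients matter; conversely each coefficient is an evaluation, by [fcoefE]. *)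
Lemma ev_ext phi p q : (forall w, fcoef p w = fcoef q w) -> ev phi p = ev phi q.
Proof.
move=> e; pose s := undup [seq cw.2 | cw <- p ++ q].
rewrite (@ev_fcoef phi p s) ?undup_uniq // ?(@ev_fcoef phi q s) ?undup_uniq //.
- by apply: eq_bigr => w _; rewrite e.
- by move=> w hw; rewrite mem_undup map_cat mem_cat hw orbT.
- by move=> w hw; rewrite mem_undup map_cat mem_cat hw.
Qed.

End Evaluation.

Lemma exchange_ev (X Y : eqType) (h : seq X -> seq Y -> kf) p q :
  ev (fun w => ev (h w) q) p = ev (fun u => ev (h^~ u) p) q.
Proof.
rewrite /ev; transitivity (\sum_(a <- p) \sum_(b <- q) a.1 * (b.1 * h a.2 b.2)).
  by apply: eq_bigr => a _; rewrite mulr_sumr.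
rewrite exchange_big /=; apply: eq_bigr => b _; rewrite mulr_sumr.
by apply: eq_bigr => a _; rewrite mulrCA.
Qed.

Definition lin (X Y : eqType) (F : seq X -> fpoly Y) (p : fpoly X) : fpoly Y :=
  flatten [seq fscale cw.1 (F cw.2) | cw <- p].

Lemma ev_lin (X Y : eqType) (F : seq X -> fpoly Y) phi p :
  ev phi (lin F p) = ev (fun w => ev phi (F w)) p.
Proof.
elim: p => [|[c w] p ih]; first by rewrite /ev !big_nil.
by rewrite ev_cons -ih -ev_scale -ev_add.
Qed.

(** * Skew derivations and Lusztig's form on a free algebra *)

Section SkewDerivations.
Variables (X : eqType) (chi : X -> X -> kf) (nu : X -> kf).
Implicit Types (phi : seq X -> kf) (kap : X -> kf) (w u v : seq X) (a b g : X).

Definition mchar kap w : kf := \prod_(g <- w) kap g.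

Lemma mchar_nil kap : mchar kap [::] = 1.
Proof. by rewrite /mchar big_nil. Qed.

Lemma mchar_cons kap g w : mchar kap (g :: w) = kap g * mchar kap w.
Proof. by rewrite /mchar big_cons. Qed.

Lemma mchar_cat kap w u : mchar kap (w ++ u) = mchar kap w * mchar kap u.
Proof. by rewrite /mchar big_cat. Qed.

Lemma mchar_rcons kap w g : mchar kap (rcons w g) = mchar kap w * kap g.
Proof. by rewrite -cats1 mchar_cat mchar_cons mchar_nil mulr1. Qed.

Lemma mchar_neq0 kap w : (forall g, kap g != 0) -> mchar kap w != 0.
Proof.
move=> h; elim: w => [|g w ih]; first by rewrite mchar_nil oner_neq0.
rewrite mchar_cons; exact: (mulf_neq0 (h g) ih).
Qed.

Lemma mchar1 kap w : {in w, forall g, kap g = 1} -> mchar kap w = 1.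
Proof. by move=> h; rewrite /mchar big_seq big1. Qed.

(* With [chi a g] = q^-(alpha_a, alpha_g), [dlw a] is e'_a and [drw a] is e*_a. *)
Fixpoint dlw a w : fpoly X :=
  match w with
  | [::] => [::]
  | g :: w' => fadd [:: ((a == g)%:R, w')] (fscale (chi a g) (fmul (fgen g) (dlw a w')))
  end.

Fixpoint drw a w : fpoly X :=
  match w with
  | [::] => [::]
  | g :: w' => fadd (fmul (fgen g) (drw a w')) [:: ((a == g)%:R * mchar (chi a) w', w')]
  end.

Lemma dl_cons phi a g w : ev phi (dlw a (g :: w)) =
  (a == g)%:R * phi w + chi a g * ev (fun u => phi (g :: u)) (dlw a w).
Proof. by rewrite /dlw -/dlw ev_add ev_word ev_scale ev_mul ev_gen. Qed.

Lemma dr_cons phi a g w : ev phi (drw a (g :: w)) =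
  ev (fun u => phi (g :: u)) (drw a w) + (a == g)%:R * (mchar (chi a) w * phi w).
Proof. by rewrite /drw -/drw ev_add ev_word ev_mul ev_gen mulrA. Qed.

Lemma dl_cat phi a w u : ev phi (dlw a (w ++ u)) =
  ev (fun v => phi (v ++ u)) (dlw a w)
  + mchar (chi a) w * ev (fun v => phi (w ++ v)) (dlw a u).
Proof.
elim: w phi => [|g w ih] phi; first by rewrite ev_nil mchar_nil add0r mul1r.
by rewrite cat_cons !dl_cons ih mchar_cons; ring.
Qed.

Lemma dr_rcons phi a w g : ev phi (drw a (rcons w g)) =
  (a == g)%:R * phi w + chi a g * ev (fun v => phi (rcons v g)) (drw a w).
Proof.
elim: w phi => [|h w ih] phi.
  by rewrite /rcons dr_cons /drw !ev_nil mchar_nil; ring.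
by rewrite rcons_cons !dr_cons ih mchar_rcons; ring.
Qed.

Lemma dl_out phi a w : a \notin w -> ev phi (dlw a w) = 0.
Proof.
elim: w phi => [|g w ih] phi; first by rewrite ev_nil.
rewrite inE negb_or dl_cons => /andP[/negPf -> h].
by rewrite ih // mul0r mulr0 addr0.
Qed.

Lemma dl_small phi a u :
  (forall v, (size v < size u)%N -> phi v = 0) -> ev phi (dlw a u) = 0.
Proof.
elim: u phi => [|g u ih] phi h; first by rewrite ev_nil.
rewrite dl_cons h // ih ?mulr0 ?addr0 // => v hv.
exact: h.
Qed.

Lemma dl_eq_in (P : pred X) phi psi a u :
  (forall v, all P v -> phi v = psi v) -> all P u ->
  ev phi (dlw a u) = ev psi (dlw a u).
Proof.
elim: u phi psi => [|g u ih] phi psi h; first by rewrite !ev_nil.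
move=> /= /andP[hg hu]; rewrite !dl_cons h //; congr (_ + _ * _).
by apply: ih => // v hv; apply: h; rewrite /= hg.
Qed.

(** Each term of [dlw a u] is a multiple of [u] with one letter [a] deleted, so a character loses
    exactly the factor [kap a]. Multiplying by [kap a] on the left avoids a division. *)
Lemma dl_mchar kap phi a u :
  ev (fun w => mchar kap w * phi w) (dlw a u) * kap a = mchar kap u * ev phi (dlw a u).
Proof.
elim: u phi => [|g u ih] phi; first by rewrite !ev_nil mul0r mulr0.
rewrite !dl_cons mchar_cons.
under eq_ev => w do rewrite mchar_cons -mulrA.
rewrite ev_Zl mulrDl -!mulrA ih.
by case: eqP => [->|_] /=; ring.
Qed.

Lemma dr_mchar kap phi a u :
  ev (fun w => mchar kap w * phi w) (drw a u) * kap a = mchar kap u * ev phi (drw a u).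
Proof.
elim: u phi => [|g u ih] phi; first by rewrite !ev_nil mul0r mulr0.
rewrite !dr_cons mchar_cons.
under eq_ev => w do rewrite mchar_cons -mulrA.
rewrite ev_Zl mulrDl -!mulrA ih.
by case: eqP => [->|_] /=; ring.
Qed.

Hypothesis chiC : forall a b, chi a b = chi b a.

(** Symmetry of [chi] is what makes the scalars agree: if the head letter is [b], its removal by
    [drw b] costs [mchar (chi b)] of the tail, which changes by [chi b a] when [a] is deleted, while
    [dlw a] passes that head at cost [chi a b]. *)
Lemma dl_dr phi a b u :
  ev (fun w => ev phi (drw b w)) (dlw a u) = ev (fun w => ev phi (dlw a w)) (drw b u).
Proof.
elim: u phi => [|g u ih] phi; first by rewrite !ev_nil.
rewrite dl_cons dr_cons.
under [X in _ + _ * X = _]eq_ev => w do rewrite dr_cons.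
under [X in _ = X + _]eq_ev => w do rewrite dl_cons.
rewrite !ev_Dl !ev_Zl ih -addrA; congr (_ + _).
rewrite mulrDr; congr (_ + _).
case: eqP => [<-|_]; last by rewrite !mul0r mulr0.
by rewrite !mul1r -dl_mchar mulrC chiC.
Qed.

(* Lusztig's form with (f_a, f_a) = [nu a]. *)
Fixpoint frm w u : kf :=
  match w with
  | [::] => (u == [::])%:R
  | a :: w' => nu a * ev (frm w') (dlw a u)
  end.

Lemma frm_cons a w u : frm (a :: w) u = nu a * ev (frm w) (dlw a u).
Proof. by []. Qed.

Lemma frm_nilr w : frm w [::] = (w == [::])%:R.
Proof. by case: w => [|a w] //=; rewrite ev_nil mulr0. Qed.

(** The recursion defining [frm] peels the first argument; this is the same adjunction in the second
    one, and symmetry of the form follows from it. *)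
Lemma frm_consr w a u : frm w (a :: u) = nu a * ev (frm^~ u) (dlw a w).
Proof.
elim: w u => [|b w ih] u; first by rewrite /= ev_nil mulr0.
rewrite frm_cons !dl_cons.
under eq_ev => v do rewrite ih.
pose E := ev (fun v => ev (frm v) (dlw b u)) (dlw a w).
have -> : ev (fun v => frm (b :: v) u) (dlw a w) = nu b * E by rewrite -ev_Zl.
have exch : ev (fun v => ev (frm^~ v) (dlw a w)) (dlw b u) = E by rewrite exchange_ev.
rewrite ev_Zl exch [chi b a]chiC [a == b]eq_sym.
by case: eqP => [->|_] /=; ring.
Qed.

Lemma frmC w u : frm w u = frm u w.
Proof.
elim: u w => [|a u ih] w; first by rewrite frm_nilr.
by rewrite frm_consr frm_cons; under eq_ev => v do rewrite ih.
Qed.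

Lemma dl_dr_nil a u : ev (frm [::]) (dlw a u) = ev (frm [::]) (drw a u).
Proof.
have dr0 : forall g w, ev (fun u0 => frm [::] (g :: u0)) (drw a w) = 0.
  by move=> g w; rewrite -[RHS](ev_0l (drw a w)).
have dl0 : forall g w, ev (fun u0 => frm [::] (g :: u0)) (dlw a w) = 0.
  by move=> g w; rewrite -[RHS](ev_0l (dlw a w)).
case: u => [|g w]; first by rewrite !ev_nil.
rewrite dl_cons dr_cons dr0 dl0 mulr0 addr0 add0r /=.
by case: w => [|h w]; rewrite ?mchar_nil ?mul1r //= !mulr0.
Qed.

(** The right derivation commutes with the left derivations that peel [w], so it can be carried down
    to the empty word, where left and right derivations agree. *)
Lemma frm_rcons w a u : frm (rcons w a) u = nu a * ev (frm w) (drw a u).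
Proof.
elim: w u => [|b w ih] u; first by rewrite frm_cons dl_dr_nil.
rewrite rcons_cons frm_cons.
under eq_ev => v do rewrite ih.
rewrite ev_Zl dl_dr mulrCA; congr (_ * _).
by rewrite -ev_Zl.
Qed.

(** The form vanishes unless both words have the same letters with the same multiplicities, so a
    character moves freely from one argument to the other. *)
Lemma frm_mchar kap w u : mchar kap u * frm w u = mchar kap w * frm w u.
Proof.
elim: w u => [|a w ih] u.
  by rewrite /=; case: eqP => [->|_]; rewrite ?mulr0.
rewrite frm_cons mulrCA -dl_mchar mchar_cons.
under eq_ev => v do rewrite ih.
by rewrite ev_Zl; ring.
Qed.

(** Peel the first argument letter by letter: a letter of [A] does not occur in [u2], and a letter
    outside [A] does not occur in [u1] and passes it with scalar 1. *)
Lemma frm_cat (A : pred X) w1 w2 u1 u2 :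
  (forall a b, A a -> ~~ A b -> chi a b = 1) ->
  all A w1 -> all A u1 -> all (predC A) w2 -> all (predC A) u2 ->
  frm (w1 ++ w2) (u1 ++ u2) = frm w1 u1 * frm w2 u2.
Proof.
move=> chi1 + + hw2 hu2; elim: w1 u1 => [|a w1 ih] u1 /=.
  move=> _ hu1; elim: w2 u2 hw2 hu2 => [|b w2 ih2] u2 /=.
    move=> _ _; rewrite -natrM mulnb; congr (_%:R : kf).
    by case: u1 {hu1} => [|? ?] //; case: u2.
  move=> /andP[hb hw2] hu2; rewrite dl_cat mchar1; last first.
    by move=> g /(allP hu1) hg; rewrite chiC chi1.
  rewrite dl_out ?mul1r ?add0r; last by apply: contra hb => /(allP hu1).
  rewrite [RHS]mulrCA -[X in _ = _ * X]ev_Zl; congr (_ * _).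
  by apply: (dl_eq_in (P := predC A)) => // v hv; apply: ih2.
move=> /andP[ha hw1] hu1; rewrite dl_cat (dl_out _ (w := u2)); last first.
  by apply/negP => /(allP hu2) /=; rewrite ha.
rewrite mulr0 addr0 -[RHS]mulrA [X in _ = _ * X]mulrC -[X in _ = _ * X]ev_Zl; congr (_ * _).
by apply: (dl_eq_in (P := A)) => // v hv; rewrite mulrC; apply: ih.
Qed.

End SkewDerivations.

(** * The operators L and E *)

Lemma qh_neq0 : qh != 0.
Proof. by rewrite tofrac_eq0 polyX_eq0. Qed.

Lemma qq_neq0 : qq != 0.
Proof. exact: (expf_neq0 2 qh_neq0). Qed.

Lemma qqD e1 e2 : qq ^ (e1 + e2) = qq ^ e1 * qq ^ e2.
Proof. exact: (expfzDr _ _ qq_neq0). Qed.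

Lemma qq_expz_neq0 e : qq ^ e != 0.
Proof. exact: (expfz_neq0 _ qq_neq0). Qed.

Lemma qq_exp_neq1 m : (0 < m)%N -> qq ^+ m != 1.
Proof.
move=> m0; rewrite /qq -exprM /qh -tofracXn -tofrac1 tofrac_eq.
apply/eqP => /(congr1 (fun p : {poly rat} => size p)).
rewrite size_polyXn size_poly1; lia.
Qed.

Definition sg (p : int) : int := (-1) ^+ absz p.

Lemma sgE p : sg p = (-1) ^ p.
Proof.
case: p => m //; rewrite /sg NegzE -exprnN abszN /=.
Qed.

Lemma sgD p m : sg (p + m) = sg p * sg m.
Proof. by rewrite !sgE exprzDr. Qed.

Lemma sgS p : sg (p + 1) = - sg p.
Proof. by rewrite sgD /sg /= mulrN1. Qed.

Lemma sgB p m : sg (p - m) = sg p * sg m.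
Proof. by rewrite sgD /sg abszN. Qed.

Lemma sg_sqr p : sg p * sg p = 1.
Proof. by rewrite /sg -exprD addnn -mul2n exprM sqrrN expr1n. Qed.

(** The scalar identity behind [Ew_Lw], stated over an arbitrary field so that [ring] sees atoms.
    There [t1], [t2], [t3], [t4] are the four values of [theta], [l] is [lam a b], [x] is [chiA a b]
    and [k] is the Kronecker delta of [a] and [b]. *)
Lemma commutation_scalars (F : fieldType)
    (e1 e2 e3 e4 e5 c c' r q k m m' f f' t1 t2 t3 t4 l x : F) :
  k * (c' * r * q) = k * c -> t3 != 0 ->
  t3 * e5 = m' * (c * e4 + q * e3) -> t2 * e2 = m * (e1 + c' * r * e4) ->
  t1 = l * t4 -> t4 * x * t2 = 1 -> t3 * l = t2 ->
  m * (t1 * m' * (c * (k * f' + x * e1) + q * f) + c' * r * e5) =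
  l * (m' * (c * e2 + q * (m * t4 * (f + c' * r * (k * f' + x * e3))))).
Proof.
move=> hk t3n0 h5 h2 -> hx ht2; rewrite -ht2 in h2 hx.
apply: (mulfI t3n0); apply/eqP; rewrite -subr_eq0; apply/eqP.
(* The difference is an explicit combination of the hypotheses; the factor [t3] was introduced
   because only [t3 * e5] is known. *)
rewrite (_ : _ - _ = m * (c' * r) * (t3 * e5 - m' * (c * e4 + q * e3))
   - c * m' * (t3 * l * e2 - m * (e1 + c' * r * e4))
   + m * m' * (c * e1 - q * (c' * r) * e3) * (t4 * x * (t3 * l) - 1)
   - m * m' * t3 * l * t4 * f' * (k * (c' * r * q) - k * c)); last by ring.
by rewrite h5 h2 hx hk !subrr !mulr0 subr0 addr0 subr0.
Qed.

Section Action.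
Variables (n : nat) (C : 'M[int]_n) (d : 'I_n -> nat).
Implicit Types (i j : 'I_n) (a b g : GA n) (w u v : seq (GA n)).
Implicit Types (phi : seq (GA n) -> kf).

Definition sform i j : int := (d i)%:Z * C i j.

Lemma qi_mulC i j e : qi d i (e * C i j) = qq ^ (e * sform i j).
Proof. by rewrite /qi /sform mulrCA. Qed.

Lemma qiD i e1 e2 : qi d i (e1 + e2) = qi d i e1 * qi d i e2.
Proof. by rewrite /qi mulrDr qqD. Qed.

Lemma qi0 i : qi d i 0 = 1.
Proof. by rewrite /qi mulr0. Qed.

Lemma qi_neq0 i e : qi d i e != 0.
Proof. exact: qq_expz_neq0. Qed.

Lemma qiV i e : qi d i e * qi d i (- e) = 1.
Proof. by rewrite -qiD subrr qi0. Qed.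

(* [cq i] = q_i^-1 - q_i is also the norm of f_i once the form is rescaled by
   kappa, see [kappa_sqr]. *)
Definition cq i : kf := qi d i (-1) - qi d i 1.
(* Letters of different slots are orthogonal. *)
Definition chiA a b : kf := if a.2 == b.2 then qq ^ (- sform a.1 b.1) else 1.
(* [lam a b] is q_i^{(-1)^k <h_i, wt b>} for a = (i, k); it is also the factor in
   f_a f_b = lam(a,b) f_b f_a + ... whenever b lies in a higher slot than a. *)
Definition lam a b : kf := qq ^ (sg a.2 * sg (b.2 + 1) * sform a.1 b.1).
Definition theta a b : kf := if a.2 < b.2 then lam a b else 1.
Definition sh a : GA n := (a.1, a.2 + 1).

Lemma lam_neq0 a b : lam a b != 0.
Proof. exact: qq_expz_neq0. Qed.

Lemma theta_neq0 a b : theta a b != 0.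
Proof. rewrite /theta; case: ifP => _; [exact: lam_neq0 | exact: oner_neq0]. Qed.

Lemma sh_inj : injective sh.
Proof. by move=> [i p] [j r] [-> /addIr ->]. Qed.

Definition gfrm := frm chiA (fun a => cq a.1).

(* Formulas (i) and (ii) of the theorem, on words whose letters need not be sorted
   by slots: [theta b] collects the weight of the slots above that of [b]. *)
Definition Lw b u : fpoly (GA n) := fscale (mchar (theta b) u)
  (fadd [:: (1, b :: u)] (fscale (cq b.1 * qi d b.1 (-1)) (drw chiA (sh b) u))).
Definition Ew a u : fpoly (GA n) := fscale (mchar (theta a) u)
  (fadd (fscale (cq a.1) (dlw chiA a u)) [:: (qi d a.1 1, rcons u (sh a))]).

Lemma ev_Lw phi b u : ev phi (Lw b u) = mchar (theta b) u *
  (phi (b :: u) + cq b.1 * qi d b.1 (-1) * ev phi (drw chiA (sh b) u)).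
Proof. by rewrite ev_scale ev_add ev_word mul1r ev_scale. Qed.

Lemma ev_Ew phi a u : ev phi (Ew a u) = mchar (theta a) u *
  (cq a.1 * ev phi (dlw chiA a u) + qi d a.1 1 * phi (rcons u (sh a))).
Proof. by rewrite ev_scale ev_add ev_word ev_scale. Qed.

Hypothesis sformC : forall i j, sform i j = sform j i.
Hypothesis Cdiag : forall i, C i i = 2.

Lemma chiAC a b : chiA a b = chiA b a.
Proof. by rewrite /chiA eq_sym sformC. Qed.

(** Slots are integers, so exactly one of [a.2 < b.2] and [b.2 < a.2 + 1] holds; in the second case
    [theta b (sh a)] is the inverse of [lam a b], as the shift reverses the sign of the exponent. *)
Lemma theta_sh a b : theta a b = lam a b * theta b (sh a).
Proof.
rewrite /theta /lam /= -addrA !sgD (_ : sg 1 = -1) // (sformC b.1).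
case: ltrP => h1; case: ltrP => h2; rewrite ?mulr1 //; try lia.
by rewrite -qqD -[LHS](expr0z qq); congr (_ ^ _); ring.
Qed.

Lemma theta_sh_chi a b : theta b (sh a) * chiA a b * theta b a = 1.
Proof.
rewrite /theta /lam /chiA /= -addrA !sgD (_ : sg 1 = -1) // (sformC b.1).
have [e|ne] := eqVneq a.2 b.2.
  rewrite e ltrDl ltr01 ltxx mulr1 -qqD -[RHS](expr0z qq); congr (_ ^ _).
  have := sg_sqr b.2; move: (sg b.2) => s; move: (sform _ _) => x h.
  rewrite (_ : s * _ * x - x = (s * s - 1) * x); last by ring.
  by rewrite h subrr mul0r.
rewrite mulr1 (_ : (b.2 < a.2 + 1) = (b.2 < a.2)); last by lia.
case: ltrP => h; last by rewrite mulr1.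
by rewrite -qqD -[RHS](expr0z qq); congr (_ ^ _); ring.
Qed.

Lemma theta_lam a b : theta a (sh b) * lam a b = theta b a.
Proof.
rewrite /theta /lam /= -addrA !sgD (_ : sg 1 = -1) // (sformC b.1).
rewrite (_ : (a.2 < b.2 + 1) = ~~ (b.2 < a.2)); last by lia.
case: ltrP => h /=; last by rewrite -qqD -[RHS](expr0z qq); congr (_ ^ _); ring.
by rewrite mul1r; congr (_ ^ _); ring.
Qed.

Lemma chiA_sh a b : chiA (sh b) (sh a) = chiA a b.
Proof. by rewrite /chiA /= (inj_eq (addIr _)) eq_sym sformC. Qed.

Lemma theta_self_sh a : theta a (sh a) = qi d a.1 2.
Proof.
rewrite /theta /= ltrDl ltr01 /lam /= -addrA sgD (_ : sg (1 + 1) = 1) // mulr1.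
by rewrite sg_sqr mul1r /qi /sform Cdiag.
Qed.

Lemma lam_adj (i j : 'I_n) p a : i = j -> lam a (i, p) * lam a (j, p + 1) = 1.
Proof.
by move=> ->; rewrite /lam /= -qqD -[RHS](expr0z qq) [in X in _ + X]sgS; congr (_ ^ _); ring.
Qed.

(** For a = b there are two extra terms: E_a deletes the [b] prepended by L_b, and L_b deletes the
    [sh a] appended by E_a. They are equal up to the common scalar ([gamma]), so no constant
    survives in the commutation. *)
Lemma Ew_Lw phi a b u :
  ev (fun v => ev phi (Ew a v)) (Lw b u) = lam a b * ev (fun v => ev phi (Lw b v)) (Ew a u).
Proof.
have hP : theta a (sh b) * ev (fun v => ev phi (Ew a v)) (drw chiA (sh b) u) =
    mchar (theta a) u * (cq a.1 * ev (fun v => ev phi (drw chiA (sh b) v)) (dlw chiA a u)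
      + qi d a.1 1 * ev (fun v => phi (rcons v (sh a))) (drw chiA (sh b) u)).
  under eq_ev => v do rewrite ev_Ew.
  by rewrite mulrC dr_mchar ev_Dl !ev_Zl (dl_dr chiAC).
have hQ : theta b a * ev (fun v => ev phi (Lw b v)) (dlw chiA a u) =
    mchar (theta b) u * (ev (fun v => phi (b :: v)) (dlw chiA a u)
      + cq b.1 * qi d b.1 (-1) * ev (fun v => ev phi (drw chiA (sh b) v)) (dlw chiA a u)).
  under eq_ev => v do rewrite ev_Lw.
  by rewrite mulrC dl_mchar ev_Dl ev_Zl.
rewrite ev_Lw (ev_Ew _ _ (b :: u)) ev_Ew (ev_Lw _ _ (rcons u _)).
rewrite dl_cons dr_rcons mchar_cons mchar_rcons chiA_sh (inj_eq sh_inj).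
move: hP hQ (theta_sh a b) (theta_sh_chi a b) (theta_lam a b).
have gamma : (a == b)%:R * (cq b.1 * qi d b.1 (-1) * qi d a.1 1) = (a == b)%:R * cq a.1.
  case: eqP => [->|_]; last by rewrite !mul0r.
  by rewrite -mulrA [qi d _ (-1) * _]mulrC qiV mulr1.
move: gamma (theta_neq0 a (sh b)).
rewrite [b == a]eq_sym; exact: commutation_scalars.
Qed.
End Action.

(** * The action on M through the operators L, and its null elements *)

Section Module.
Variables (n : nat) (C : 'M[int]_n) (d : 'I_n -> nat).
Implicit Types (i j : 'I_n) (a b g : GA n) (w u v x y : seq (GA n)).
Implicit Types (phi : seq (GA n) -> kf) (m p r : fpoly (GA n)).
Hypothesis sformC : forall i j, sform C d i j = sform C d j i.
Hypothesis Cdiag : forall i, C i i = 2.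
Local Notation gfrm := (gfrm C d).
Local Notation Lw := (Lw C d).
Local Notation Ew := (Ew C d).
Local Notation theta := (theta C d).
Local Notation lam := (lam C d).
Local Notation chiA := (chiA C d).

Lemma theta_self a : theta a a = 1.
Proof. by rewrite /theta ltxx. Qed.

Lemma gfrmC x u : gfrm x u = gfrm u x.
Proof. exact: (frmC _ (chiAC sformC)). Qed.

(** Prepending [b] is adjoint to the left derivation, and the right derivation by [sh b] to
    appending [sh b], so the two summands of [Lw] match those of [Ew]. When [theta b] is moved
    across the form, the letter [sh b] contributes q_i^2 and turns q_i^-1 into q_i. *)
Lemma Lw_adj x b u : ev (gfrm x) (Lw b u) = ev (gfrm^~ u) (Ew b x).
Proof.
rewrite ev_Lw ev_Ew.
have h1 : mchar (theta b) u * gfrm x (b :: u) = mchar (theta b) x * gfrm x (b :: u).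
  have := frm_mchar chiA (fun a => cq d a.1) (theta b) x (b :: u).
  by rewrite mchar_cons theta_self mul1r.
have h2 : mchar (theta b) u * gfrm (rcons x (sh b)) u =
    mchar (theta b) x * qi d b.1 2 * gfrm (rcons x (sh b)) u.
  have := frm_mchar chiA (fun a => cq d a.1) (theta b) (rcons x (sh b)) u.
  by rewrite mchar_rcons (theta_self_sh _ Cdiag).
have h3 : cq d b.1 * ev (gfrm x) (drw chiA (sh b) u) = gfrm (rcons x (sh b)) u.
  by rewrite /gfrm (frm_rcons _ (chiAC sformC)).
have h4 : gfrm x (b :: u) = cq d b.1 * ev (gfrm^~ u) (dlw chiA b x).
  by rewrite /gfrm (frm_consr _ (chiAC sformC)).
have h5 : qi d b.1 (-1) * qi d b.1 2 = qi d b.1 1 by rewrite -qiD.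
rewrite mulrDr h1 h4 mulrDr; congr (_ + _).
transitivity (qi d b.1 (-1) * (mchar (theta b) u * (cq d b.1 * ev (gfrm x) (drw chiA (sh b) u)))).
  by ring.
by rewrite h3 h2 -h5; ring.
Qed.

Lemma Ew_adj x a u : ev (gfrm x) (Ew a u) = ev (gfrm^~ u) (Lw a x).
Proof.
under eq_ev => v do rewrite gfrmC.
by rewrite -Lw_adj; under eq_ev => v do rewrite gfrmC.
Qed.

Definition act w m : fpoly (GA n) := foldr (fun a => lin (Lw a)) m w.

Lemma act_cat w1 w2 m : act (w1 ++ w2) m = act w1 (act w2 m).
Proof. exact: foldr_cat. Qed.

Lemma ev_act phi w m : ev phi (act w m) = ev (fun u => ev phi (act w [:: (1, u)])) m.
Proof.
elim: w phi => [|a w ih] phi /=.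
  by apply: eq_ev => u; rewrite ev_word mul1r.
rewrite ev_lin ih; apply: eq_ev => u.
by rewrite ev_lin.
Qed.

Lemma act_Ew phi a w m :
  ev phi (lin (Ew a) (act w m)) = mchar (lam a) w * ev phi (act w (lin (Ew a) m)).
Proof.
elim: w phi => [|b w ih] phi; first by rewrite mchar_nil mul1r.
rewrite [act _ _]/= ev_lin ev_lin.
under eq_ev => u do rewrite (Ew_Lw sformC).
by rewrite ev_Zl -ev_lin ih mchar_cons /= [in RHS]ev_lin mulrA.
Qed.

(* The left action of [r] on M takes its values in the radical of the form. *)
Definition null r := forall x u, ev (fun w => ev (gfrm x) (act w [:: (1, u)])) r = 0.

Lemma null_act r x m : null r -> ev (fun w => ev (gfrm x) (act w m)) r = 0.
Proof.
move=> h; under eq_ev => w do rewrite ev_act.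
rewrite exchange_ev -[RHS](ev_0l m); apply: eq_ev => u.
exact: h.
Qed.

(** A right factor only changes the vector acted upon; a left factor is moved to the other argument
    of the form by adjunction, one letter at a time. *)
Lemma null_mul p r q : null r -> null (fmul p (fmul r q)).
Proof.
move=> h x u; rewrite ev_mul -[RHS](ev_0l p); apply: eq_ev => w1.
rewrite ev_mul exchange_ev -[RHS](ev_0l q); apply: eq_ev => w3.
elim: w1 x => [|a w1 ih] x.
  by under eq_ev => w do rewrite cat0s act_cat; apply: null_act.
have adj w : ev (gfrm x) (act ((a :: w1) ++ w ++ w3) [:: (1, u)]) =
    ev (fun y => ev (gfrm y) (act (w1 ++ w ++ w3) [:: (1, u)])) (Ew a x).
  by rewrite [act _ _]/= ev_lin exchange_ev; apply: eq_ev => v; rewrite Lw_adj.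
under eq_ev => w do rewrite adj.
rewrite exchange_ev -[RHS](ev_0l (Ew a x)); apply: eq_ev => y.
exact: ih.
Qed.

Lemma null_ideal (R : fpoly (GA n) -> Prop) :
  (forall r, R r -> null r) -> forall r, in_ideal R r -> null r.
Proof.
move=> hR r; elim=> {r} [|r|p q _ hp _ hq|p r q _|p q e _ hp].
- by move=> x u; rewrite ev_nil.
- exact: hR.
- by move=> x u; rewrite ev_add hp hq addr0.
- exact: null_mul.
- by move=> x u; rewrite -(ev_ext _ e) hp.
Qed.

(* Words are built from the right by the operators E, which commute with the
   action of a homogeneous [r] up to scalars and have adjoints; this reduces the
   nullity of [r] to the vector 1. *)
Lemma null_homogeneous r (mu : GA n -> kf) : (forall a, mu a != 0) ->
  (forall a cw, cw \in r -> cw.1 != 0 -> mchar (lam a) cw.2 = mu a) ->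
  (forall x, ev (fun w => ev (gfrm x) (act w [:: (1, [::])])) r = 0) ->
  null r.
Proof.
move=> mu0 hom base x u.
have [k] := ubnP (size u); elim: k x u => // k ih x u.
case/lastP: u => [|u s] hu; first exact: base.
rewrite size_rcons ltnS in hu.
(* The last letter [s] is created by [Ew a] with [a] one slot below it. *)
pose a : GA n := (s.1, s.2 - 1).
have sa : sh a = s by rewrite /sh /a /= subrK; case: (s).
pose T x := fun u => ev (fun w => ev (gfrm x) (act w [:: (1, u)])) r.
have e1 : ev (fun w => ev (gfrm x) (act w (Ew a u))) r = ev (T x) (Ew a u).
  by under eq_ev => w do rewrite ev_act; rewrite exchange_ev.
(* By homogeneity E_a crosses every word of [r] with the same scalar, and its adjoint L_a then acts
   on [x], leaving the shorter vector [u]. *)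
have e2 : mu a * ev (fun w => ev (gfrm x) (act w (Ew a u))) r =
    ev (fun y => T y u) (Lw a x).
  rewrite -ev_Zl -exchange_ev; apply: eq_ev_in => cw hcw cw0.
  rewrite -(hom a cw hcw cw0).
  have -> : ev (gfrm x) (act cw.2 (Ew a u)) = ev (gfrm x) (act cw.2 (lin (Ew a) [:: (1, u)])).
    rewrite ev_act [RHS]ev_act ev_lin ev_word mul1r //.
  rewrite -act_Ew ev_lin exchange_ev; apply: eq_ev => v.
  exact: Ew_adj.
have e3 : ev (T x) (Ew a u) = 0.
  apply: (mulfI (mu0 a)); rewrite mulr0 -e1 e2 -[RHS](ev_0l (Lw a x)).
  by apply: eq_ev => y; apply: ih.
(* The derivation part of [Ew a u] involves only shorter words, covered by induction; what remains
   is an invertible multiple of the value at [rcons u s]. *)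
move: e3; rewrite ev_Ew dl_small; last first.
  by move=> v hv; apply: ih; apply: leq_trans hu; apply: ltnW.
rewrite mulr0 add0r sa => /eqP; rewrite mulf_eq0 mulf_eq0.
rewrite (negPf (mchar_neq0 _ (theta_neq0 C d a))) (negPf (qi_neq0 d a.1 1)) /=.
by move/eqP.
Qed.
End Module.

(** * The Serre elements *)

Section QBinomials.
Variable t : kf.
Hypothesis t_neq0 : t != 0.
Hypothesis t_generic : forall m, (0 < m)%N -> t ^+ m - t ^- m != 0.

Lemma qnum_mul m : qnum t m * (t - t^-1) = t ^+ m - t ^- m.
Proof. exact: (divfK (t_generic (ltn0Sn 0))). Qed.

Lemma qnum_neq0 m : (0 < m)%N -> qnum t m != 0.
Proof.
move=> hm; apply/eqP => h; have := qnum_mul m; rewrite h mul0r => /esym/eqP.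
by rewrite (negPf (t_generic hm)).
Qed.

Lemma qfactS m : qfact t m.+1 = qfact t m * qnum t m.+1.
Proof. by rewrite /qfact big_nat_recr. Qed.

Lemma qfact0 : qfact t 0 = 1.
Proof. by rewrite /qfact big_geq. Qed.

Lemma qfact_neq0 m : qfact t m != 0.
Proof.
elim: m => [|m ih]; first by rewrite qfact0 oner_neq0.
rewrite qfactS; exact: (mulf_neq0 ih (qnum_neq0 (ltn0Sn m))).
Qed.

Lemma qbinom_fact m r :
  qbinom t m r * (qfact t r * qfact t (m - r)) = qfact t m.
Proof. exact: (divfK (mulf_neq0 (qfact_neq0 _) (qfact_neq0 _))). Qed.

Lemma qbinomnn m : qbinom t m m = 1.
Proof.
apply: (mulIf (mulf_neq0 (qfact_neq0 m) (qfact_neq0 (m - m)))).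
by rewrite (qbinom_fact m m) subnn qfact0 mul1r mulr1.
Qed.

Lemma qbinomn0 m : qbinom t m 0 = 1.
Proof.
apply: (mulIf (mulf_neq0 (qfact_neq0 0) (qfact_neq0 (m - 0)))).
by rewrite (qbinom_fact m 0) subn0 qfact0 !mul1r.
Qed.

Lemma qbinom_shift m r : (r < m)%N ->
  qbinom t m r * qnum t (m - r) = qbinom t m r.+1 * qnum t r.+1.
Proof.
move=> hr; apply: (mulIf (mulf_neq0 (qfact_neq0 r) (qfact_neq0 (m - r.+1)))).
have := qbinom_fact m r; have := qbinom_fact m r.+1.
have -> : (m - r = (m - r.+1).+1)%N by lia.
rewrite !qfactS => h h'.
transitivity (qfact t m); first by rewrite -h'; ring.
by rewrite -h; ring.
Qed.

Lemma qbinom_pascal m e :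
  qbinom t (m + e).+2 m.+1 * t ^+ m.+1 =
  t ^+ (m + e).+2 * qbinom t (m + e).+1 m + qbinom t (m + e).+1 m.+1.
Proof.
have := qbinom_fact (m + e).+2 m.+1; have := qbinom_fact (m + e).+1 m.
have := qbinom_fact (m + e).+1 m.+1.
have -> : ((m + e).+2 - m.+1 = e.+1)%N by lia.
have -> : ((m + e).+1 - m = e.+1)%N by lia.
have -> : ((m + e).+1 - m.+1 = e)%N by lia.
rewrite (qfactS (m + e).+1) (qfactS m) (qfactS e).
(* With the q-factorials cleared, the Pascal rule reduces to this identity between three
   q-numbers. *)
have key : qnum t (m + e).+2 * t ^+ m.+1 = t ^+ (m + e).+2 * qnum t m.+1 + qnum t e.+1.
  have eN : (m + e).+2 = (m.+1 + e.+1)%N by lia.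
  have := qnum_mul (m + e).+2; have := qnum_mul m.+1; have := qnum_mul e.+1.
  have := mulfV (expf_neq0 m.+1 t_neq0); have := mulfV (expf_neq0 e.+1 t_neq0).
  have : t - t^-1 != 0 := t_generic (ltn0Sn 0).
  rewrite eN exprD invfM; move: (qnum t _) (qnum t m.+1) (qnum t e.+1) (t - t^-1).
  move: (t ^+ m.+1) (t ^+ e.+1) (t ^- m.+1) (t ^- e.+1).
  move=> a b a' b' x y z D D0 hb ha hz hy hx; apply: (mulIf D0).
  transitivity (a * (x * D)); first by ring.
  rewrite hx; transitivity (a * b * (y * D) + z * D); last by ring.
  rewrite hy hz; transitivity (a * a * b - (a * a') * b'); first by ring.
  rewrite ha; transitivity (a * a * b - (a * a') * b + b - b'); last by ring.
  by rewrite ha; ring.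
move=> q3 q2 q1.
apply: (mulIf (mulf_neq0 (mulf_neq0 (qfact_neq0 m) (qnum_neq0 (ltn0Sn m)))
   (mulf_neq0 (qfact_neq0 e) (qnum_neq0 (ltn0Sn e))))).
rewrite [LHS]mulrAC q1 -[LHS]mulrA key.
transitivity (t ^+ (m + e).+2 * qnum t m.+1 * qfact t (m + e).+1
  + qnum t e.+1 * qfact t (m + e).+1); first by ring.
by rewrite -{1}q2 -{1}q3; ring.
Qed.

(** The alternating sum has partial sums in closed form, so each induction step is one use of the
    Pascal rule; at m = M the closed form is opposite to the last term of the full sum. *)
Lemma qbinom_alternating_part M m : (m <= M)%N ->
  \sum_(r < m.+1) (-1) ^+ r * qbinom t M.+1 r * t ^+ (M * (M.+1 - r)) =
  (-1) ^+ m * t ^+ (M.+1 * (M - m)) * qbinom t M m.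
Proof.
elim: m => [|m ih] hm.
  by rewrite big_ord1 /= !qbinomn0 !subn0 mulnC; ring.
rewrite big_ord_recr /= ih; last exact: ltnW.
pose e := (M - m.+1)%N; have eM : M = (m + e).+1 by rewrite /e; lia.
have := qbinom_pascal m e; rewrite -eM.
have -> : (M.+1 - m.+1 = e.+1)%N by lia.
have -> : (M - m = e.+1)%N by lia.
have -> : (M - m.+1 = e)%N by lia.
have -> : (M * e.+1 = M.+1 * e + m.+1)%N by nia.
have -> : (M.+1 * e.+1 = M.+1 * e + M.+1)%N by lia.
rewrite (exprD t _ m.+1) (exprD t _ M.+1) [(-1) ^+ m.+1]exprS => h.
move: (t ^+ (M.+1 * e)) (t ^+ m.+1) (t ^+ M.+1) ((-1) ^+ m) h => x y z s h.
transitivity (s * x * (z * qbinom t M m - qbinom t M.+1 m.+1 * y)); first by ring.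
by rewrite h; ring.
Qed.

Lemma qbinom_alternating M :
  \sum_(r < M.+2) (-1) ^+ r * qbinom t M.+1 r * t ^+ (M * (M.+1 - r)) = 0.
Proof.
rewrite big_ord_recr qbinom_alternating_part //= !subnn !muln0 !qbinomnn exprS.
by ring.
Qed.

(** This geometric sum is the coefficient produced by a derivation by [a] on the m-th power of [a]
    when [chi a a] is t^-2. *)
Lemma geometric_qnum m : (\sum_(k < m) (t ^- 2) ^+ k) * t ^+ m = t * qnum t m.
Proof.
apply: (mulIf (t_generic (ltn0Sn 0))); rewrite expr1 -[RHS]mulrA qnum_mul.
elim: m => [|m ih]; first by rewrite big_ord0 !mul0r expr0 invr1 subrr mulr0.
have hk : t ^- m * t ^+ m = 1 := mulVf (expf_neq0 m t_neq0).
have he : (t ^- 2) ^+ m = t ^- m * t ^- m.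
  by rewrite exprVn -exprM mulnC exprM expr2 invfM.
rewrite big_ord_recr /= he [t ^+ m.+1]exprS [(t * t ^+ m)^-1]invfM.
move: (\sum_(k < m) _) ih hk => S; move: (t^-1) (t ^+ m) (t ^- m) => s x y ih hk.
transitivity (t * (S * x * (t - s)) + (t - s) * t * y * (y * x)); first by ring.
by rewrite ih hk; ring.
Qed.
End QBinomials.

(** * Skew derivatives of the Serre element, with t = q_i and M = -c_ij *)

Section SerreDerivative.
Variables (X : eqType) (chi : X -> X -> kf) (t : kf) (a b : X) (M : nat).
Hypothesis t_neq0 : t != 0.
Hypothesis t_generic : forall m, (0 < m)%N -> t ^+ m - t ^- m != 0.
Hypothesis ab : a != b.
Hypothesis chi_aa : chi a a = t ^- 2.
Hypothesis chi_ab : chi a b = t ^+ M.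
Hypothesis chi_ba : chi b a = t ^+ M.

Lemma mchar_nseq (kap : X -> kf) g m : mchar kap (nseq m g) = kap g ^+ m.
Proof.
elim: m => [|m ih]; first by rewrite mchar_nil expr0.
by rewrite /= mchar_cons ih exprS.
Qed.

Lemma dl_nseq phi g m : ev phi (dlw chi g (nseq m g)) =
  (\sum_(k < m) chi g g ^+ k) * phi (nseq m.-1 g).
Proof.
elim: m phi => [|m ih] phi; first by rewrite ev_nil big_ord0 mul0r.
rewrite dl_cons eqxx ih big_ord_recl expr0 [RHS]mulrDl -/nseq; congr (_ + _).
rewrite mulrA mulr_sumr; case: m {ih} => [|m]; first by rewrite !big_ord0 !mul0r.
by congr (_ * _); apply: eq_bigr => k _; rewrite -exprS.
Qed.

Lemma notin_nseq (g h : X) m : g != h -> g \notin nseq m h.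
Proof. by move=> gh; rewrite mem_nseq (negPf gh) andbF. Qed.

(** The word with M - r letters [a] before [b] and r after it arises twice: from term r by deleting
    an [a] before [b], and from term r + 1 by deleting one after [b]. The two coefficients agree up
    to the alternating sign. *)
Lemma serre_coef r : (r < M.+1)%N ->
  qbinom t M.+1 r * (\sum_(k < M.+1 - r) (t ^- 2) ^+ k) =
  qbinom t M.+1 r.+1 * ((t ^- 2) ^+ (M.+1 - r.+1) * t ^+ M * (\sum_(k < r.+1) (t ^- 2) ^+ k)).
Proof.
move=> hr.
have h1 := geometric_qnum t_neq0 t_generic (M.+1 - r).
have h2 := geometric_qnum t_neq0 t_generic r.+1.
have h3 := qbinom_shift t_neq0 t_generic hr.
apply: (mulIf (mulf_neq0 (expf_neq0 (M.+1 - r) t_neq0) (expf_neq0 r.+1 t_neq0))).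
move: h1 h2; set S1 := (\sum_(k < M.+1 - r) _); set S2 := (\sum_(k < r.+1) _) => h1 h2.
transitivity (qbinom t M.+1 r * (S1 * t ^+ (M.+1 - r)) * t ^+ r.+1); first by ring.
rewrite h1; transitivity (t * t ^+ r.+1 * (qbinom t M.+1 r * qnum t (M.+1 - r))); first by ring.
rewrite h3.
transitivity (qbinom t M.+1 r.+1 * (t ^- 2 ^+ (M.+1 - r.+1) * t ^+ M * t ^+ (M.+1 - r))
   * (S2 * t ^+ r.+1)); last by ring.
rewrite h2.
have -> : t ^- 2 ^+ (M.+1 - r.+1) * t ^+ M * t ^+ (M.+1 - r) = t ^+ r.+1; last by ring.
have -> : (M.+1 - r = (M.+1 - r.+1).+1)%N by lia.
rewrite -mulrA -exprD.
have -> : (M + (M.+1 - r.+1).+1 = 2 * (M.+1 - r.+1) + r.+1)%N by lia.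
rewrite exprD mulrA exprM -exprMn.
by rewrite (mulVf (expf_neq0 2 t_neq0)) expr1n mul1r.
Qed.

(** The derivative by [b] is a power of [a] times the vanishing alternating sum; the derivative by
    [a] cancels in pairs by [serre_coef]; any other letter is absent. *)
Lemma serre_derivative l phi :
  \sum_(r < M.+2) (-1) ^+ r * qbinom t M.+1 r *
     ev phi (dlw chi l (nseq (M.+1 - r) a ++ b :: nseq r a)) = 0.
Proof.
have [->|lb] := eqVneq l b.
  have := congr1 (fun c => c * phi (nseq M.+1 a)) (qbinom_alternating t_neq0 t_generic M).
  rewrite mulr_suml mul0r => h; rewrite -[RHS]h {h}.
  apply: eq_bigr => r _; rewrite dl_cat dl_out ?add0r; last by rewrite notin_nseq // eq_sym.
  rewrite dl_cons eqxx mul1r dl_out; last by rewrite notin_nseq // eq_sym.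
  rewrite mulr0 addr0 mchar_nseq chi_ba -exprM -nseqD subnK; last by rewrite -ltnS.
  by rewrite mulrA.
have [->|la] := eqVneq l a; last first.
  rewrite big1 // => r _; rewrite dl_out ?mulr0 // mem_cat inE (negPf lb) /=.
  by rewrite negb_or !notin_nseq.
pose G r := phi (nseq (M - r) a ++ b :: nseq r a).
pose B m := \sum_(k < m) (t ^- 2) ^+ k.
have expand r : (r <= M.+1)%N -> ev phi (dlw chi a (nseq (M.+1 - r) a ++ b :: nseq r a)) =
    B (M.+1 - r)%N * G r + (t ^- 2) ^+ (M.+1 - r) * t ^+ M * B r * G r.-1.
  move=> hr; rewrite dl_cat dl_nseq dl_cons (negPf ab) mul0r add0r dl_nseq mchar_nseq.
  rewrite chi_aa chi_ab -/(B _) -/(B r) -subnS subSS; congr (_ + _).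
  rewrite !mulrA; case: r hr => [|r] hr; first by rewrite /B big_ord0 mulr0 !mul0r.
  by rewrite /G /= subSS.
transitivity (\sum_(r < M.+2) ((-1) ^+ r * qbinom t M.+1 r * (B (M.+1 - r)%N * G r)
   + (-1) ^+ r * qbinom t M.+1 r * ((t ^- 2) ^+ (M.+1 - r) * t ^+ M * B r * G r.-1))).
  by apply: eq_bigr => r _; rewrite expand ?mulrDr // -ltnS.
(* The last term has no [a] before [b] and the first has none after it; once these two zero
   contributions are split off, the sums pair up with an index shift. *)
rewrite big_split /= big_ord_recr [X in _ + X]big_ord_recl /=.
rewrite subnn (_ : B 0%N = 0); last by rewrite /B big_ord0.
rewrite mul0r !mulr0 mul0r mulr0 addr0 add0r.
rewrite -big_split big1 // => r _ /=.
have := serre_coef (ltn_ord r); rewrite -/(B _) -/(B _) => h.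
rewrite /bump /= !add1n ?add0n exprS.
transitivity ((-1) ^+ r * G r * (qbinom t M.+1 r * B (M.+1 - r)%N
  - qbinom t M.+1 r.+1 * (t ^- 2 ^+ (M.+1 - r.+1) * t ^+ M * B r.+1))); first by ring.
by rewrite h subrr mulr0.
Qed.
End SerreDerivative.

Lemma dr_out (X : eqType) (chi : X -> X -> kf) phi a w :
  a \notin w -> ev phi (drw chi a w) = 0.
Proof.
elim: w phi => [|g w ih] phi; first by rewrite ev_nil.
rewrite inE negb_or dr_cons => /andP[/negPf -> h].
by rewrite ih // mul0r addr0.
Qed.

(** * The defining relations act by zero modulo the radical *)

Section Relations.
Variables (n : nat) (C : 'M[int]_n) (d : 'I_n -> nat).
Implicit Types (i j : 'I_n) (a b g : GA n) (w u v x y : seq (GA n)).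
Implicit Types (phi : seq (GA n) -> kf).
Hypothesis sformC : forall i j, sform C d i j = sform C d j i.
Hypothesis Cdiag : forall i, C i i = 2.
Hypothesis Coff : forall i j, i != j -> C i j <= 0.
Hypothesis d_gt0 : forall i, (0 < d i)%N.
Local Notation gfrm := (gfrm C d).
Local Notation Lw := (Lw C d).
Local Notation theta := (theta C d).
Local Notation lam := (lam C d).
Local Notation chiA := (chiA C d).
Local Notation act := (act C d).

Lemma Lw_top phi b u : all (fun g : GA n => g.2 <= b.2) u -> ev phi (Lw b u) = phi (b :: u).
Proof.
move=> /allP h; rewrite ev_Lw mchar1 ?mul1r; last first.
  by move=> g /h hg; rewrite /theta ltNge hg.
rewrite dr_out ?mulr0 ?addr0 //; apply/negP => /h /=.
by rewrite gerDl.
Qed.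

Definition slot_ge (a b : GA n) := b.2 <= a.2.

Lemma slot_ge_trans : transitive slot_ge.
Proof. by move=> b a c h1 h2; apply: le_trans h2 h1. Qed.

(** Applied from the right end, each letter meets only letters of its own or lower slots, so L just
    prepends it. Words of factored elements are sorted, hence are recovered from their action on
    1. *)
Lemma act_sorted phi w : sorted slot_ge w -> ev phi (act w [:: (1, [::])]) = phi w.
Proof.
elim: w phi => [|a w ih] phi hw; first by rewrite ev_word mul1r.
rewrite [act _ _]/= ev_lin ih; last exact: path_sorted hw.
by apply: Lw_top; apply: order_path_min hw; apply: slot_ge_trans.
Qed.

Lemma act_two phi a b : ev phi (act [:: a; b] [:: (1, [::])]) =
  theta a b * (phi [:: a; b] + (sh a == b)%:R * (cq d a.1 * qi d a.1 (-1) * phi [::])).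
Proof.
rewrite [act _ _]/= ev_lin.
rewrite (_ : ev _ _ = ev (fun w => ev phi (Lw a w)) (act [:: b] [:: (1, [::])])); last by [].
rewrite act_sorted // ev_Lw mchar_cons mchar_nil mulr1 dr_cons /= ev_nil mchar_nil.
by rewrite add0r mul1r; ring.
Qed.

(** Derivations by letters of different slots commute, because [chiA] is 1 between slots. *)
Lemma gfrm_swap x a b : a.2 != b.2 -> gfrm x [:: a; b] = gfrm x [:: b; a].
Proof.
move=> ab; rewrite /gfrm !(frm_consr _ (chiAC sformC)).
have com : forall phi u, ev (fun v => ev phi (dlw chiA b v)) (dlw chiA a u)
    = ev (fun v => ev phi (dlw chiA a v)) (dlw chiA b u).
  move=> phi u; elim: u phi => [|g u ih] phi; first by rewrite !ev_nil.
  rewrite !dl_cons.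
  under [X in _ + _ * X = _]eq_ev => v do rewrite dl_cons.
  under [X in _ = _ + _ * X]eq_ev => v do rewrite dl_cons.
  rewrite !ev_Dl !ev_Zl ih.
  have hab : (a == g)%:R * chiA b g = (a == g)%:R :> kf.
    by case: eqP => [<-|_]; rewrite ?mul0r // /chiA eq_sym (negPf ab) mulr1.
  have hba : (b == g)%:R * chiA a g = (b == g)%:R :> kf.
    by case: eqP => [<-|_]; rewrite ?mul0r // /chiA (negPf ab) mulr1.
  rewrite -{1}hab -[in RHS]hba; ring.
under [X in _ * X = _]eq_ev => v do rewrite (frm_consr _ (chiAC sformC)).
under [X in _ = _ * X]eq_ev => v do rewrite (frm_consr _ (chiAC sformC)).
by rewrite !ev_Zl com mulrCA.
Qed.

Lemma ev_serre (X : eqType) (phi : seq X -> kf) (g : 'I_n -> X) i j :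
  ev phi (serre C d g i j) =
  \sum_(r < (absz (1 - C i j)).+1) (-1) ^+ r * qbinom (qq ^+ d i) (absz (1 - C i j)) r *
     phi (nseq (absz (1 - C i j) - r) (g i) ++ g j :: nseq r (g i)).
Proof.
rewrite /ev /serre big_map -[X in iota 0 X]subn0 -/(index_iota 0 _) big_mkord.
by [].
Qed.

Lemma qq_generic i m : (0 < m)%N -> (qq ^+ d i) ^+ m - (qq ^+ d i) ^- m != 0.
Proof.
move=> hm; rewrite subr_eq0; apply/eqP => h.
have hdm : (0 < (d i * m) * 2)%N by rewrite !muln_gt0 d_gt0 hm.
apply: (negP (qq_exp_neq1 hdm)); apply/eqP.
rewrite exprM expr2 exprM {1}h.
exact: (mulVf (expf_neq0 _ (expf_neq0 _ qq_neq0))).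
Qed.

Lemma gfrm_serre x i j p : i != j -> ev (gfrm x) (serre C d (fun l => (l, p) : GA n) i j) = 0.
Proof.
move=> ij; rewrite ev_serre.
case: x => [|a x].
  by apply: big1 => r _ /=; case: (nseq _ _) => [|? ?] /=; rewrite mulr0.
rewrite /gfrm /=.
pose M := absz (C i j).
have eN : absz (1 - C i j) = M.+1 by have := Coff ij; rewrite /M; lia.
rewrite eN.
under eq_bigr => r _ do rewrite mulrCA.
rewrite -mulr_sumr (serre_derivative (t := qq ^+ d i)) ?mulr0 //.
- exact: (expf_neq0 _ qq_neq0).
- exact: qq_generic.
- by apply/eqP => -[e]; move: ij; rewrite e eqxx.
- by rewrite /chiA /= eqxx /sform Cdiag -exprM exprnN; congr (_ ^ _); lia.
- rewrite /chiA /= eqxx /sform -exprM exprnP; congr (_ ^ _).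
  have := Coff ij; rewrite /M => h; nia.
- rewrite /chiA /= eqxx sformC /sform -exprM exprnP; congr (_ ^ _).
  have := Coff ij; rewrite /M => h; nia.
Qed.

Lemma null_serre p i j : i != j -> null C d (serre C d (fun l => (l, p) : GA n) i j).
Proof.
move=> ij; pose N := absz (1 - C i j).
apply: (null_homogeneous sformC Cdiag (mu := fun a => lam a (i, p) ^+ N * lam a (j, p))).
- by move=> a; exact: (mulf_neq0 (expf_neq0 _ (lam_neq0 _ _ _ _)) (lam_neq0 _ _ _ _)).
- move=> a cw /mapP[r]; rewrite mem_iota => /andP[_ hr] -> /= _.
  rewrite mchar_cat mchar_cons !mchar_nseq mulrCA -exprD subnK; last by rewrite -ltnS.
  by rewrite mulrC.
(* All letters lie in slot [p], so the words are sorted and act on 1 by themselves. *)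
move=> x; rewrite -(gfrm_serre x p ij) !ev_serre; apply: eq_bigr => r _.
congr (_ * _); apply: act_sorted; rewrite -/N.
have : all (fun g : GA n => g.2 == p) (nseq (N - r) (i, p) ++ (j, p) :: nseq r (i, p)).
  by rewrite all_cat /= !all_nseq /= eqxx !orbT.
elim: (_ ++ _) => [|a w ih] //= /andP[/eqP ha hw].
rewrite (path_sortedE slot_ge_trans) ih // andbT.
by apply/allP => b /(allP hw) /eqP hb; rewrite /slot_ge ha hb.
Qed.

Lemma null_far i j (m p : int) : m + 1 < p ->
  null C d (fsub (fmul (fgen ((i, m) : GA n)) (fgen ((j, p) : GA n)))
               (fscale (qi d i ((-1) ^+ absz (p - m + 1) * C i j))
                       (fmul (fgen ((j, p) : GA n)) (fgen ((i, m) : GA n))))).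
Proof.
move=> mp.
apply: (null_homogeneous sformC Cdiag (mu := fun a => lam a (i, m) * lam a (j, p))).
- by move=> a; exact: (mulf_neq0 (lam_neq0 _ _ _ _) (lam_neq0 _ _ _ _)).
- move=> a cw; rewrite !inE => /orP[] /eqP -> /= _; rewrite !mchar_cons mchar_nil mulr1 //.
  by rewrite mulrC.
move=> x; rewrite ev_sub ev_scale !ev_mul !ev_gen !cat1s !act_two.
have hn : ((i, m + 1) == (j, p) :> GA n) = false.
  by apply/negbTE/eqP => -[_ e]; move: mp; rewrite e ltxx.
have hn' : ((j, p + 1) == (i, m) :> GA n) = false.
  by apply/negbTE/eqP => -[_ e]; move: mp; rewrite -e; lia.
rewrite /sh /= hn hn' !mul0r !addr0.
rewrite (gfrm_swap x (a := (j, p))) /=; last by apply/eqP; lia.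
rewrite /theta /= (_ : m < p); last by lia.
rewrite (_ : p < m = false); last by lia.
rewrite mul1r qi_mulC /lam /= -mulrBl -[X in X - _]mulr1.
rewrite (_ : sg m * sg (p + 1) = (-1) ^+ absz (p - m + 1)) ?mulr1 ?subrr ?mul0r //.
by rewrite -/(sg _) addrAC sgB mulrC.
Qed.

Lemma null_adj i j (p : int) :
  null C d (fsub (fmul (fgen ((i, p) : GA n)) (fgen ((j, p + 1) : GA n)))
     (fadd (fscale (qi d i (C i j)) (fmul (fgen ((j, p + 1) : GA n)) (fgen ((i, p) : GA n))))
           (@fconst (GA n) ((i == j)%:R * (1 - qi d i 2))))).
Proof.
apply: (null_homogeneous sformC Cdiag (mu := fun a => lam a (i, p) * lam a (j, p + 1))).
- by move=> a; exact: (mulf_neq0 (lam_neq0 _ _ _ _) (lam_neq0 _ _ _ _)).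
- move=> a cw; rewrite /= !inE => /or3P[] /eqP -> /= hc.
  + by rewrite !mchar_cons mchar_nil mulr1.
  + by rewrite !mchar_cons mchar_nil mulr1 mulrC.
  (* The constant has the weight of the quadratic terms only for i = j; otherwise its coefficient is
     zero, a case that [null_homogeneous] excludes from the weight condition. *)
  rewrite mchar_nil lam_adj //; apply/eqP; apply: contraR hc => /negPf ->.
  by rewrite mul0r mulr0.
move=> x; rewrite ev_sub ev_add ev_scale !ev_mul !ev_gen ev_const !cat1s !act_two.
rewrite /sh /= ev_word mul1r.
have hn : ((j, p + 1 + 1) == (i, p) :> GA n) = false.
  by apply/negbTE/eqP => -[_ e]; lia.
rewrite hn mul0r addr0 (gfrm_swap x (a := (j, p + 1))) /=; last by apply/eqP; lia.
rewrite /theta /= ltrDl ltr01 (_ : p + 1 < p = false) ?mul1r; last by lia.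
have -> : lam (i, p) (j, p + 1) = qi d i (C i j).
  by rewrite /lam /= -addrA sgD (_ : sg (1 + 1) = 1) // mulr1 sg_sqr -[C i j]mul1r qi_mulC.
rewrite (_ : ((i, p + 1) == (j, p + 1) :> GA n) = (i == j)); last first.
  by rewrite xpair_eqE eqxx andbT.
rewrite mulrDr opprD addrACA subrr add0r.
case: eqP => [<-|_] /=; last by rewrite !mul0r mulr0 subrr.
(* The constant comes out as q_i^2 (q_i^-1 - q_i) q_i^-1 = 1 - q_i^2. *)
rewrite Cdiag /cq mulrBl -!qiD !mul1r mulrA mulrBr -!qiD.
by rewrite (_ : 2 + (-1 + -1) = 0 :> int) // (_ : 2 + (1 + -1) = 2 :> int) // qi0 subrr.
Qed.

Lemma null_relA r : relA C d r -> null C d r.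
Proof. by case=> *; [exact: null_serre | exact: null_far | exact: null_adj]. Qed.

Lemma null_in_ideal r : in_ideal (relA C d) r -> null C d r.
Proof. by apply: null_ideal => //; apply: null_relA. Qed.
End Relations.

(** * The form on factored elements *)

Section Factorisation.
Variables (n : nat) (C : 'M[int]_n) (d : 'I_n -> nat).
Implicit Types (i j : 'I_n) (b g : GA n) (a : int).
Implicit Types (phi : seq (GA n) -> kf) (psi : seq 'I_n -> kf).
Implicit Types (U V : fpoly 'I_n) (s : seq (fpoly 'I_n)) (t : fterm n).
Hypothesis sformC : forall i j, sform C d i j = sform C d j i.
Hypothesis d_gt0 : forall i, (0 < d i)%N.
Local Notation gfrm := (gfrm C d).
Local Notation chiA := (chiA C d).

Definition embw a (w : seq 'I_n) : seq (GA n) := [seq (l, a) | l <- w].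

Lemma ev_emb phi a U : ev phi (emb a U) = ev (fun w => phi (embw a w)) U.
Proof. by rewrite /ev /emb big_map. Qed.

Lemma ev_eprime psi i U : ev psi (eprime C d i U) = ev (fun w => ev psi (eprime_w C d i w)) U.
Proof. exact: (ev_lin (eprime_w C d i)). Qed.

Definition chi0 i j : kf := qi d i (- C i j).

Lemma chiA_slot a i j : chiA (i, a) (j, a) = chi0 i j.
Proof. by rewrite /chiA eqxx /chi0 /= /qi /sform mulrN. Qed.

Lemma ev_eprime_w psi i w : ev psi (eprime_w C d i w) = ev psi (dlw chi0 i w).
Proof.
elim: w psi => [|j w ih] psi //.
rewrite dl_cons [eprime_w _ _ _ _]/= ev_add ev_scale ev_mul ev_gen ih; congr (_ + _).
by rewrite eq_sym; case: (i == j); rewrite ?ev_word ?ev_nil ?mul0r.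
Qed.

Lemma dl_embw phi a i w :
  ev phi (dlw chiA (i, a) (embw a w)) = ev (fun v => phi (embw a v)) (dlw chi0 i w).
Proof.
elim: w phi => [|j w ih] phi; first by rewrite !ev_nil.
by rewrite [embw a _]/= -/(embw a w) !dl_cons ih chiA_slot xpair_eqE eqxx andbT.
Qed.

Definition lusw := frm chi0 (fun i => (1 - qi d i 2)^-1).

Lemma lusz_wE w V : lusz_w C d w V = ev (lusw w) V.
Proof.
elim: w V => [|j w ih] V /=; first by rewrite fcoefE.
rewrite ih ev_eprime -ev_Zl; apply: eq_ev => v.
by rewrite ev_eprime_w.
Qed.

(** Here kappa_i^2 = q_i (q_i^-1 - q_i)^2, and 1 - q_i^2 = q_i (q_i^-1 - q_i). *)
Lemma kappa_sqr i : kappa d i ^+ 2 * (1 - qi d i 2)^-1 = cq d i.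
Proof.
have q2 : 1 - qi d i 2 != 0.
  rewrite subr_eq0 eq_sym (_ : qi d i 2 = qq ^+ (d i * 2)); last first.
    by rewrite /qi exprnP; congr (_ ^ _); lia.
  by apply: qq_exp_neq1; rewrite muln_gt0 d_gt0.
apply: (mulIf q2); rewrite (mulfVK q2) /kappa exprMn -exprM mulnC exprM -/qq.
rewrite (_ : qq ^+ d i = qi d i 1); last by rewrite /qi mulr1.
rewrite -/(cq d i) {2}/cq expr2 mulrCA [qi d i 1 * _]mulrBr -!qiD qi0 mulrC.
by congr (_ * _); congr (_ * (_ - _)).
Qed.

Lemma gfrm_embw a w v : gfrm (embw a w) (embw a v) = kapw d w * kapw d w * lusw w v.
Proof.
elim: w v => [|j w ih] v.
  by rewrite /kapw big_nil !mul1r /=; congr (_%:R); case: v.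
rewrite [embw a (_ :: _)]/= -/(embw a w) /gfrm frm_cons dl_embw /= -/(gfrm).
under eq_ev => u do rewrite ih.
rewrite ev_Zl /kapw big_cons -(kappa_sqr j) expr2.
by ring.
Qed.

Lemma formL_emb a U V :
  formL C d U V = ev (fun w => ev (gfrm w) (emb a V)) (emb a U).
Proof.
rewrite ev_emb /formL /lusztig /kscale big_map; apply: eq_bigr => -[c w] _ /=.
rewrite -mulrA; congr (_ * _); rewrite lusz_wE ev_emb -ev_Zl /ev big_map.
apply: eq_bigr => -[c' v] _ /=; rewrite gfrm_embw -!mulrA; congr (_ * _).
(* [kscale] gives each argument its own [kapw]; the two factors agree on words with nonzero pairing,
   which yields the square in [gfrm_embw]. *)
have := frm_mchar chi0 (fun i => (1 - qi d i 2)^-1) (kappa d) w v.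
by rewrite -/lusw /mchar -!/(kapw d _) mulrCA => ->.
Qed.

Lemma mem_emb a U cw : cw \in emb a U -> exists w, cw.2 = embw a w.
Proof. by case/mapP => c _ ->; exists c.2. Qed.

Lemma evalT_slots a s cw : cw \in evalT a s ->
  all (fun g : GA n => a <= g.2) cw.2 && sorted (@slot_ge n) cw.2.
Proof.
elim: s a cw => [|U s ih] a cw /=; first by rewrite inE => /eqP ->.
case/allpairsP => -[p q] /= [/ih /andP[hp sp] /mem_emb[w hq] ->] /=.
have hw : all (fun g : GA n => g.2 == a) q.2 by rewrite hq all_map; apply/allP => l _ /=.
rewrite all_cat; apply/andP; split.
  apply/andP; split; last by apply: sub_all hw => g /eqP ->.
  by apply: sub_all hp => g /= hg; lia.
rewrite (sorted_pairwise (@slot_ge_trans n)) pairwise_cat.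
rewrite -!(sorted_pairwise (@slot_ge_trans n)) sp /=; apply/andP; split.
  apply/allrelP => g h /(allP hp) hg /(allP hw) /eqP hh; rewrite /slot_ge hh.
  by lia.
rewrite (sorted_pairwise (@slot_ge_trans n)).
elim: (q.2) hw => //= g v ihv /andP[/eqP hg hv]; rewrite ihv // andbT.
by apply/allP => h /(allP hv) /eqP hh; rewrite /slot_ge hg hh.
Qed.

(** Split off the lowest slot by [frm_cat], taking for [A] the letters in slots above [a]. *)
Lemma evalT_factor a s s' : size s = size s' ->
  ev (fun w => ev (gfrm w) (evalT a s')) (evalT a s) =
  \prod_(m < size s) formL C d (nth (@fone _) s m) (nth (@fone _) s' m).
Proof.
elim: s s' a => [|U s ih] [|V s'] a //=.
  by move=> _; rewrite big_ord0 !ev_one.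
move=> [hs]; rewrite big_ord_recl /= -(ih s' (a + 1) hs) (formL_emb a) mulrC.
rewrite ev_mul -[RHS]mulrC -ev_Zl; apply: eq_ev_in => -[c w1] h1 _ /=.
rewrite mulrC -ev_Zl; apply: eq_ev_in => -[c' w2] h2 _ /=.
rewrite mulrC ev_mul -ev_Zl; apply: eq_ev_in => -[e u1] h3 _ /=.
rewrite mulrC -ev_Zl; apply: eq_ev_in => -[e' u2] h4 _ /=.
have big c0 w s0 : (c0, w) \in evalT (a + 1) s0 -> all (fun g : GA n => a < g.2) w.
  by move/evalT_slots => /andP[h _]; apply: sub_all h => g /=; lia.
have low c0 w U0 : (c0, w) \in emb a U0 -> all (predC (fun g : GA n => a < g.2)) w.
  by move/mem_emb => [v /= ->]; rewrite all_map; apply/allP => l _ /=; rewrite ltxx.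
rewrite /gfrm (frm_cat _ (chiAC sformC) (A := fun g : GA n => a < g.2)) ; first by rewrite mulrC.
- by move=> g h hg hh; rewrite /chiA; case: eqP => // gh; move: hh; rewrite -gh hg.
- exact: big h1.
- exact: big h3.
- exact: low h2.
- exact: low h4.
Qed.

Lemma ev_evalT_front phi a k s :
  ev phi (evalT a (nseq k (@fone _) ++ s)) = ev phi (evalT (a + k%:Z) s).
Proof.
elim: k a phi => [|k ih] a phi /=; first by rewrite addr0.
rewrite ev_mul; under eq_ev => w do rewrite ev_word mul1r cats0.
by rewrite ih -addrA -intS.
Qed.

Lemma ev_evalT_back phi a k s :
  ev phi (evalT a (s ++ nseq k (@fone _))) = ev phi (evalT a s).
Proof.
elim: s a phi => [|U s ih] a phi; last by rewrite /= !ev_mul ih.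
elim: k a phi => [|k ih] a phi //=.
rewrite ev_mul; under eq_ev => w do rewrite ev_word mul1r cats0.
exact: ih.
Qed.

(** [formT] compares two terms on a common range of slots, where [comp] supplies the factor 1
    outside each term; this padding does not change the product. *)
Lemma ev_evalT_comp phi t (lo : int) N :
  lo <= t.1 -> t.1 + (size t.2)%:Z <= lo + N%:Z ->
  ev phi (evalT lo (mkseq (fun m => Defs.comp t (lo + m%:Z)) N)) = ev phi (evalT t.1 t.2).
Proof.
case: t => a s /= h1 h2.
pose k := absz (a - lo); pose l := (N - (k + size s))%N.
have ek : a = lo + k%:Z by rewrite /k; lia.
have -> : mkseq (fun m => Defs.comp (a, s) (lo + m%:Z)) N =
    nseq k (@fone _) ++ s ++ nseq l (@fone _).
  have eN : N = (k + (size s + l))%N by rewrite /l; lia.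
  apply: (@eq_from_nth _ (@fone _)).
    by rewrite size_mkseq !size_cat !size_nseq.
  move=> m; rewrite size_mkseq => hm; rewrite nth_mkseq // /Defs.comp /=.
  rewrite !nth_cat !size_nseq !nth_nseq.
  case: ltnP => hk.
    by rewrite (_ : a <= lo + m%:Z = false) //; lia.
  rewrite (_ : a <= lo + m%:Z); last by lia.
  rewrite (_ : (lo + m%:Z < a + (size s)%:Z) = (m - k < size s)%N); last by lia.
  by case: ltnP => hs /=; [congr nth; lia | case: ltnP].
by rewrite ev_evalT_front -ek ev_evalT_back.
Qed.

Lemma formT_evalT t u :
  formT C d t u = ev (fun w => ev (gfrm w) (evalT u.1 u.2)) (evalT t.1 t.2).
Proof.
rewrite /formT; set lo := Num.min _ _; set hi := Num.max _ _.
pose N := absz (hi - lo).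
have ht : lo <= t.1 /\ t.1 + (size t.2)%:Z <= lo + N%:Z by rewrite /N /lo /hi; lia.
have hu : lo <= u.1 /\ u.1 + (size u.2)%:Z <= lo + N%:Z by rewrite /N /lo /hi; lia.
rewrite -(ev_evalT_comp _ ht.1 ht.2).
under eq_ev => w do rewrite -(ev_evalT_comp _ hu.1 hu.2).
rewrite evalT_factor ?size_mkseq //; apply: eq_bigr => m _.
by rewrite !nth_mkseq.
Qed.

Lemma ev_evalFE phi (F : seq (fterm n)) :
  ev phi (evalFE F) = \sum_(t <- F) ev phi (evalT t.1 t.2).
Proof.
elim: F => [|t F ih]; first by rewrite big_nil ev_nil.
by rewrite big_cons -ih -ev_add.
Qed.

Lemma formFE_gfrm F G : formFE C d F G = ev (fun w => ev (gfrm w) (evalFE G)) (evalFE F).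
Proof.
rewrite ev_evalFE; apply: eq_bigr => t _.
under eq_ev => w do rewrite ev_evalFE.
rewrite /ev; under [RHS]eq_bigr => cw _ do rewrite mulr_sumr.
rewrite exchange_big /=; apply: eq_bigr => u _.
exact: formT_evalT.
Qed.

Lemma evalFE_sorted F cw : cw \in evalFE F -> sorted (@slot_ge n) cw.2.
Proof.
by case/flattenP => p /mapP[t _ ->] /evalT_slots /andP[].
Qed.
End Factorisation.

(** * Straightening *)

Section Congruence.
Variables (X : eqType) (R : fpoly X -> Prop).
Implicit Types (p q r : fpoly X) (phi : seq X -> kf).

(** Equality in the free algebra: the lists may differ in order and in uncollected terms. *)
Definition feq p q := forall phi, ev phi p = ev phi q.

Lemma feq_mul p p' q q' : feq p p' -> feq q q' -> feq (fmul p q) (fmul p' q').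
Proof.
by move=> e e' phi; rewrite !ev_mul e; apply: eq_ev => w; rewrite e'.
Qed.

Lemma ev_mulA phi p q r : ev phi (fmul (fmul p q) r) = ev phi (fmul p (fmul q r)).
Proof.
rewrite !ev_mul; apply: eq_ev => w; rewrite ev_mul; apply: eq_ev => u.
by apply: eq_ev => v; rewrite catA.
Qed.

Lemma ev_mulDl phi p q r : ev phi (fmul (fadd p q) r) = ev phi (fmul p r) + ev phi (fmul q r).
Proof. by rewrite !ev_mul ev_add. Qed.

Lemma ev_mulZl phi c p r : ev phi (fmul (fscale c p) r) = c * ev phi (fmul p r).
Proof. by rewrite !ev_mul ev_scale. Qed.

Lemma ev_mulDr phi p q r : ev phi (fmul r (fadd p q)) = ev phi (fmul r p) + ev phi (fmul r q).
Proof. by rewrite !ev_mul -ev_Dl; apply: eq_ev => w; rewrite ev_add. Qed.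

Lemma ev_mulZr phi c p r : ev phi (fmul r (fscale c p)) = c * ev phi (fmul r p).
Proof. by rewrite !ev_mul -ev_Zl; apply: eq_ev => w; rewrite ev_scale. Qed.

Lemma ev_mul1l phi p : ev phi (fmul (fone X) p) = ev phi p.
Proof. by rewrite ev_mul ev_one. Qed.

Lemma ev_mul1r phi p : ev phi (fmul p (fone X)) = ev phi p.
Proof. by rewrite ev_mul; apply: eq_ev => w; rewrite ev_one cats0. Qed.

Lemma ideal_feq p q : feq p q -> in_ideal R p -> in_ideal R q.
Proof. by move=> e; apply: ideal_ext => w; rewrite !fcoefE. Qed.

Lemma ideal_scale c p : in_ideal R p -> in_ideal R (fscale c p).
Proof.
move=> h; apply: ideal_feq (ideal_mul (fconst X c) (fone X) h) => phi.
by rewrite ev_mul ev_const ev_scale ev_mul1r.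
Qed.

Lemma fcongr_feq p q : feq p q -> fcongr R p q.
Proof.
move=> e; apply: ideal_feq (ideal_nil R) => phi.
by rewrite ev_sub e ev_nil subrr.
Qed.

Lemma fcongr_trans q p r : fcongr R p q -> fcongr R q r -> fcongr R p r.
Proof.
move=> h h'; apply: ideal_feq (ideal_add h h') => phi.
by rewrite ev_add !ev_sub; ring.
Qed.

Lemma fcongr_add p p' q q' :
  fcongr R p p' -> fcongr R q q' -> fcongr R (fadd p q) (fadd p' q').
Proof.
move=> h h'; apply: ideal_feq (ideal_add h h') => phi.
by rewrite !(ev_add, ev_sub); ring.
Qed.

Lemma fcongr_scale c p q : fcongr R p q -> fcongr R (fscale c p) (fscale c q).
Proof.
move=> h; apply: ideal_feq (ideal_scale c h) => phi.
by rewrite !(ev_scale, ev_sub); ring.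
Qed.

Lemma fcongr_mull a p q : fcongr R p q -> fcongr R (fmul a p) (fmul a q).
Proof.
move=> h; apply: ideal_feq (ideal_mul a (fone X) h) => phi.
rewrite ev_sub !ev_mul -mulN1r -ev_Zl -ev_Dl; apply: eq_ev => w.
by rewrite ev_mul1r ev_sub mulN1r.
Qed.

Lemma fcongr_mulr b p q : fcongr R p q -> fcongr R (fmul p b) (fmul q b).
Proof.
move=> h; apply: ideal_feq (ideal_mul (fone X) b h) => phi.
by rewrite ev_mul1l ev_sub !ev_mul ev_sub.
Qed.

Lemma fcongr_lin (Y : eqType) (F G : seq Y -> fpoly X) (p : fpoly Y) :
  (forall cw, cw \in p -> fcongr R (F cw.2) (G cw.2)) -> fcongr R (lin F p) (lin G p).
Proof.
elim: p => [|cw p ih] h; first exact: fcongr_feq.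
apply: fcongr_add; first by apply: fcongr_scale; apply: h; rewrite inE eqxx.
by apply: ih => cw' h'; apply: h; rewrite inE h' orbT.
Qed.

Lemma ev_support (g : seq X -> kf) c phi p :
  (forall w, fcoef p w != 0 -> g w = c) -> ev (fun w => g w * phi w) p = c * ev phi p.
Proof.
move=> h; pose s := undup [seq cw.2 | cw <- p].
have sub : {subset [seq cw.2 | cw <- p] <= s} by move=> w; rewrite mem_undup.
rewrite !(ev_fcoef _ (undup_uniq _) sub) mulr_sumr; apply: eq_bigr => w _.
have [->|/h ->] := eqVneq (fcoef p w) 0; first by rewrite !mul0r mulr0.
by rewrite mulrCA.
Qed.

Definition word (w : seq X) : fpoly X := [:: (1, w)].

End Congruence.

Section Straightening.
Variables (n : nat) (C : 'M[int]_n) (d : 'I_n -> nat).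
Implicit Types (i j : 'I_n) (a b g : GA n) (w u v x y : seq (GA n)).
Implicit Types (phi : seq (GA n) -> kf).
Hypothesis sformC : forall i j, sform C d i j = sform C d j i.
Hypothesis Cdiag : forall i, C i i = 2.
Local Notation lam := (lam C d).
Local Notation chiA := (chiA C d).
Local Notation Aeq := (Aeq C d).

(** The scalar for moving [sh a] leftwards past [b]; it is the inverse of [lam a b], so (iii) can be
    indexed by the same letter [a] as (i). *)
Definition lamV a b : kf := qq ^ (- (sg a.2 * sg (b.2 + 1) * sform C d a.1 b.1)).

Lemma gen_far a g : a.2 + 1 < g.2 ->
  Aeq (word [:: a; g]) (fscale (lam a g) (word [:: g; a])).
Proof.
case: a g => i k [j p] h.
apply: ideal_feq (ideal_rel (relA_far C d i j h)) => phi.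
rewrite !ev_sub !ev_scale !ev_mul !ev_gen !ev_word !mul1r qi_mulC; congr (_ - _ * _).
by rewrite /lam /= -/(sg _) addrAC sgB [sg k * _]mulrC.
Qed.

Lemma gen_far_right a g : g.2 < a.2 ->
  Aeq (word [:: g; sh a]) (fscale (lamV a g) (word [:: sh a; g])).
Proof.
case: a g => i k [j p] h.
have h' : p + 1 < k + 1 by rewrite ltrD2r; exact: h.
apply: ideal_feq (ideal_rel (relA_far C d j i h')) => phi.
rewrite !ev_sub !ev_scale !ev_mul !ev_gen !ev_word !mul1r qi_mulC; congr (_ - _ * _).
rewrite /lamV /= -/(sg _) sformC; congr (_ ^ _).
by rewrite sgS sgB !sgS; ring.
Qed.

Lemma lam_slot i j k : lam (i, k) (j, k + 1) = qi d i (C i j).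
Proof.
by rewrite /lam /= -addrA sgD (_ : sg (1 + 1) = 1) // mulr1 sg_sqr -[C i j]mul1r qi_mulC.
Qed.

Lemma lamV_slot i j k : lamV (i, k) (j, k) = qi d j (C j i).
Proof.
rewrite /lamV /= sgS mulrN sg_sqr sformC -[C j i]mul1r qi_mulC.
by rewrite !mulN1r opprK mul1r.
Qed.

Lemma gen_adj a g : g.2 = a.2 + 1 ->
  Aeq (word [:: a; g]) (fadd (fscale (lam a g) (word [:: g; a]))
     (fscale ((sh a == g)%:R * (1 - qi d a.1 2)) (word [::]))).
Proof.
case: a g => i k [j p] h; have {h} -> : p = k + 1 by exact: h.
apply: ideal_feq (ideal_rel (relA_adj C d i j k)) => phi.
rewrite !ev_sub !ev_add !ev_scale ev_const !ev_mul !ev_gen !ev_word !mul1r.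
by rewrite lam_slot /sh xpair_eqE eqxx andbT.
Qed.

Lemma gen_adj_right a g : g.2 = a.2 ->
  Aeq (word [:: g; sh a]) (fadd (fscale (lamV a g) (word [:: sh a; g]))
     (fscale ((a == g)%:R * (1 - qi d a.1 2)) (word [::]))).
Proof.
case: a g => i k [j p] h; have {h} -> : p = k by exact: h.
apply: ideal_feq (ideal_rel (relA_adj C d j i k)) => phi.
rewrite !ev_sub !ev_add !ev_scale ev_const !ev_mul !ev_gen !ev_word !mul1r.
rewrite lamV_slot xpair_eqE eqxx andbT [j == i]eq_sym.
by case: eqP => [->|] //=; rewrite !mul0r.
Qed.

(** Formula (i) on a single word of xy, the factor zw being left out; [move_left] is likewise (iii)
    on a word of zw. *)
Definition move_right a u := fscale (mchar (lam a) u)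
  (fadd (word (rcons u a)) (fscale (cq d a.1 * qi d a.1 (-1)) (drw chiA (sh a) u))).

Definition move_left a u := fscale (mchar (lamV a) u)
  (fadd (word (sh a :: u)) (fscale (cq d a.1 * qi d a.1 (-1)) (dlw chiA a u))).

Lemma cq_scalar i : cq d i * qi d i (-1) * qi d i 2 = 1 - qi d i 2.
Proof. by rewrite -mulrA -qiD /cq mulrBl -!qiD qi0. Qed.

Lemma ev_move_right phi a u : ev phi (move_right a u) = mchar (lam a) u *
  (phi (rcons u a) + cq d a.1 * qi d a.1 (-1) * ev phi (drw chiA (sh a) u)).
Proof. by rewrite ev_scale ev_add ev_word ev_scale mul1r. Qed.

Lemma ev_move_left phi a u : ev phi (move_left a u) = mchar (lamV a) u *
  (phi (sh a :: u) + cq d a.1 * qi d a.1 (-1) * ev phi (dlw chiA a u)).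
Proof. by rewrite ev_scale ev_add ev_word ev_scale mul1r. Qed.

Lemma slot_straighten a v : all (fun g : GA n => g.2 == a.2 + 1) v ->
  Aeq (word (a :: v)) (move_right a v).
Proof.
elim: v => [|g v ih] => [_|/andP[/eqP hg hv]].
  apply: fcongr_feq => phi; rewrite ev_move_right ev_word mchar_nil ev_nil /=.
  by ring.
apply: (fcongr_trans (q := fmul (word [:: a; g]) (word v))).
  by apply: fcongr_feq => phi; rewrite ev_mul !ev_word !mul1r.
apply: fcongr_trans (fcongr_mulr _ (gen_adj hg)) _.
apply: (fcongr_trans (q := fadd (fscale (lam a g) (fmul (word [:: g]) (word (a :: v))))
   (fscale ((sh a == g)%:R * (1 - qi d a.1 2)) (word v)))).
  by apply: fcongr_feq => phi; rewrite ev_mulDl !ev_mulZl ev_add !ev_scale !ev_mul !ev_word !mul1r.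
have rest := fcongr_scale (lam a g) (fcongr_mull (word [:: g]) (ih hv)).
apply: fcongr_trans (fcongr_add rest (fcongr_feq _ (fun=> erefl))) _.
apply: fcongr_feq => phi.
rewrite [RHS]ev_move_right ev_add !ev_scale ev_mul ev_word mul1r ev_move_right.
rewrite ev_word mul1r mchar_cons dr_cons.
(* The constant created by [g = sh a] stands in front of [v] with no character, while [move_right]
   carries [lam a] and [drw] carries [chiA (sh a)]; on slot k+1 these are mutually inverse. *)
have inv : mchar (lam a) v * mchar (chiA (sh a)) v = 1.
  elim: (v) hv => [|h v' ihv] /=; first by rewrite !mchar_nil mulr1.
  move=> /andP[/eqP hh hv']; rewrite !mchar_cons mulrACA ihv // mulr1.
  rewrite /chiA /lam /= hh eqxx -qqD -[RHS](expr0z qq); congr (_ ^ _).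
  by rewrite -addrA sgD (_ : sg (1 + 1) = 1) // mulr1 sg_sqr mul1r subrr.
have lamg : (sh a == g)%:R * lam a g = (sh a == g)%:R * qi d a.1 2.
  case: eqP => [<-|_]; last by rewrite !mul0r.
  by case: (a) => i k; rewrite lam_slot Cdiag.
rewrite -cq_scalar rcons_cons.
transitivity (lam a g * mchar (lam a) v * (phi (g :: rcons v a) +
   cq d a.1 * qi d a.1 (-1) * ev (fun u => phi (g :: u)) (drw chiA (sh a) v)) +
   cq d a.1 * qi d a.1 (-1) * phi v * ((sh a == g)%:R * qi d a.1 2)); first by rewrite /=; ring.
rewrite -lamg -[X in _ + _ * X]mulr1 -inv.
by ring.
Qed.

(** Letters above slot k+1 differ from [sh a]: they contribute a scalar and no correction. *)
Lemma straighten_left a x v : all (fun g : GA n => a.2 + 1 < g.2) x ->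
  all (fun g : GA n => g.2 == a.2 + 1) v ->
  Aeq (word (a :: x ++ v)) (move_right a (x ++ v)).
Proof.
move=> + hv; elim: x => [|g x ih] => [_|/andP[hg hx]]; first exact: slot_straighten.
apply: (fcongr_trans (q := fmul (word [:: a; g]) (word (x ++ v)))).
  by apply: fcongr_feq => phi; rewrite ev_mul !ev_word !mul1r.
apply: fcongr_trans (fcongr_mulr _ (gen_far hg)) _.
apply: (fcongr_trans (q := fscale (lam a g) (fmul (word [:: g]) (word (a :: x ++ v))))).
  by apply: fcongr_feq => phi; rewrite ev_mulZl ev_scale !ev_mul !ev_word !mul1r.
apply: fcongr_trans (fcongr_scale _ (fcongr_mull _ (ih hx))) _.
apply: fcongr_feq => phi.
rewrite [RHS]ev_move_right ev_scale ev_mul ev_word mul1r ev_move_right mchar_cons dr_cons.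
have -> : (sh a == g) = false by apply/eqP => e; move: hg; rewrite -e ltxx.
by rewrite mul0r addr0 mulrA.
Qed.

Lemma slot_straighten_right a v : all (fun g : GA n => g.2 == a.2) v ->
  Aeq (word (rcons v (sh a))) (move_left a v).
Proof.
elim: v => [|g v ih] => [_|/andP[/eqP hg hv]].
  apply: fcongr_feq => phi; rewrite ev_move_left ev_word mchar_nil ev_nil /=.
  by ring.
apply: (fcongr_trans (q := fmul (word [:: g]) (word (rcons v (sh a))))).
  by apply: fcongr_feq => phi; rewrite ev_mul !ev_word !mul1r.
apply: fcongr_trans (fcongr_mull _ (ih hv)) _.
apply: (fcongr_trans (q := fscale (mchar (lamV a) v) (fadd (fmul (word [:: g; sh a]) (word v))
   (fscale (cq d a.1 * qi d a.1 (-1)) (fmul (word [:: g]) (dlw chiA a v)))))).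
  apply: fcongr_feq => phi.
  by rewrite ev_mul ev_word mul1r ev_move_left ev_scale ev_add ev_scale !ev_mul !ev_word !mul1r.
have first := fcongr_mulr (word v) (gen_adj_right hg).
apply: fcongr_trans (fcongr_scale _ (fcongr_add first (fcongr_feq _ (fun=> erefl)))) _.
apply: fcongr_feq => phi.
rewrite [RHS]ev_move_left ev_scale ev_add ev_scale ev_mulDl !ev_mulZl !ev_mul !ev_word !mul1r.
rewrite mchar_cons dl_cons /=.
(* The derivation passes [g] with [chiA a g], cancelling the [lamV a g] of the front factor. *)
have inv : chiA a g * lamV a g = 1.
  rewrite /chiA /lamV hg eqxx -qqD -[RHS](expr0z qq); congr (_ ^ _).
  by rewrite sgS mulrN sg_sqr mulN1r opprK addNr.
have lamg : (a == g)%:R * lamV a g = (a == g)%:R * qi d a.1 2.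
  case: eqP => [<-|_]; last by rewrite !mul0r.
  by case: (a) => i k; rewrite lamV_slot Cdiag.
rewrite -cq_scalar.
transitivity (mchar (lamV a) v * (lamV a g * phi (sh a :: g :: v) +
  cq d a.1 * qi d a.1 (-1) * phi v * ((a == g)%:R * qi d a.1 2) +
  cq d a.1 * qi d a.1 (-1) * 1 * ev (fun u => phi (g :: u)) (dlw chiA a v))); first by ring.
by rewrite -lamg -inv; ring.
Qed.

Lemma straighten_right a v x : all (fun g : GA n => g.2 == a.2) v ->
  all (fun g : GA n => g.2 < a.2) x ->
  Aeq (word (rcons (v ++ x) (sh a))) (move_left a (v ++ x)).
Proof.
move=> hv; elim/last_ind: x => [|x g ih]; first by rewrite cats0 => _; apply: slot_straighten_right.
rewrite all_rcons => /andP[hg hx]; rewrite -rcons_cat.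
apply: (fcongr_trans (q := fmul (word (v ++ x)) (word [:: g; sh a]))).
  by apply: fcongr_feq => phi; rewrite ev_mul !ev_word !mul1r -!cats1 -!catA.
apply: fcongr_trans (fcongr_mull _ (gen_far_right hg)) _.
apply: (fcongr_trans (q := fscale (lamV a g) (fmul (word (rcons (v ++ x) (sh a))) (word [:: g])))).
  apply: fcongr_feq => phi.
  by rewrite ev_mulZr ev_scale !ev_mul !ev_word !mul1r -cats1 -!catA.
apply: fcongr_trans (fcongr_scale _ (fcongr_mulr _ (ih hx))) _.
apply: fcongr_feq => phi.
rewrite [RHS]ev_move_left ev_scale ev_mul ev_move_left mchar_rcons.
rewrite -[rcons (v ++ x) g]cats1 [in RHS]dl_cat (dl_out _ _ (w := [:: g])); last first.
  by rewrite inE; apply/eqP => e; move: hg; rewrite -e ltxx.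
rewrite mulr0 addr0 ev_word mul1r.
under eq_ev => w do rewrite ev_word mul1r.
by rewrite mulrA [lamV a g * _]mulrC.
Qed.
End Straightening.

Lemma dr_cat_out (X : eqType) (chi : X -> X -> kf) phi a w u : a \notin w ->
  ev phi (drw chi a (w ++ u)) = ev (fun v => phi (w ++ v)) (drw chi a u).
Proof.
elim: w phi => [|g w ih] phi; first by [].
rewrite inE negb_or => /andP[/negPf hg hw].
by rewrite cat_cons dr_cons hg mul0r addr0 ih.
Qed.

(** * The form on the bosonic extension *)

Section Form.
Variables (n : nat) (C : 'M[int]_n) (d : 'I_n -> nat).
Implicit Types (i j : 'I_n) (a b g : GA n) (k : int).
Implicit Types (phi : seq (GA n) -> kf) (psi : seq 'I_n -> kf) (p q X W : fpoly (GA n)).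
Hypothesis sformC : forall i j, sform C d i j = sform C d j i.
Hypothesis Cdiag : forall i, C i i = 2.
Hypothesis Coff : forall i j, i != j -> C i j <= 0.
Hypothesis d_gt0 : forall i, (0 < d i)%N.
Local Notation gfrm := (gfrm C d).
Local Notation lam := (lam C d).
Local Notation lamV := (lamV C d).
Local Notation chiA := (chiA C d).
Local Notation Ew := (Ew C d).
Local Notation act := (act C d).
Local Notation Aeq := (Aeq C d).

Lemma ev_estar psi i U : ev psi (estar C d i U) = ev (fun w => ev psi (estar_w C d i w)) U.
Proof. exact: (ev_lin (estar_w C d i)). Qed.

Lemma mchar_chi0 i w : mchar (chi0 C d i) w = qi d i (- \sum_(l <- w) C i l).
Proof.
elim: w => [|j w ih]; first by rewrite mchar_nil big_nil oppr0 qi0.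
by rewrite mchar_cons big_cons ih opprD qiD.
Qed.

Lemma ev_estar_w psi i w : ev psi (estar_w C d i w) = ev psi (drw (chi0 C d) i w).
Proof.
elim: w psi => [|j w ih] psi //.
rewrite dr_cons [estar_w _ _ _ _]/= ev_add ev_mul ev_gen ih mchar_chi0; congr (_ + _).
by rewrite eq_sym; case: (i == j); rewrite ?ev_word ?ev_nil ?mul0r ?mul1r.
Qed.

Lemma dr_embw phi k i w :
  ev phi (drw chiA (i, k) (embw k w)) = ev (fun v => phi (embw k v)) (drw (chi0 C d) i w).
Proof.
elim: w phi => [|j w ih] phi; first by rewrite !ev_nil.
rewrite [embw k _]/= -/(embw k w) !dr_cons ih xpair_eqE eqxx andbT; congr (_ + _ * (_ * _)).
elim: (w) => [|l v ihv]; first by rewrite !mchar_nil.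
by rewrite [embw k _]/= -/(embw k v) !mchar_cons ihv chiA_slot.
Qed.

Lemma mchar_lam a w : mchar (lam a) w = qi d a.1 (sg a.2 * pairh C a.1 (wtwA w)).
Proof.
elim: w => [|g w ih].
  rewrite mchar_nil /pairh big1 ?mulr0 ?qi0 // => j _.
  by rewrite /wtwA big_nil mul0r.
rewrite mchar_cons ih (_ : pairh C a.1 (wtwA (g :: w)) =
    sg (g.2 + 1) * C a.1 g.1 + pairh C a.1 (wtwA w)).
  by rewrite mulrDr qiD mulrA qi_mulC.
rewrite /pairh (eq_bigr (fun j => wtA g j * C a.1 j + wtwA w j * C a.1 j)); last first.
  by move=> j _; rewrite /wtwA big_cons mulrDl.
rewrite big_split /=; congr (_ + _).
rewrite (bigD1 g.1) //= big1 ?addr0; first by rewrite /wtA eqxx.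
by move=> j hj; rewrite /wtA eq_sym (negPf hj) mul0r.
Qed.

Lemma mchar_lamV a w : mchar (lamV a) w = qi d a.1 (- (sg a.2 * pairh C a.1 (wtwA w))).
Proof.
rewrite -mulN1r -[LHS]mul1r -(qiV d a.1 (sg a.2 * pairh C a.1 (wtwA w))) mulN1r.
rewrite mulrAC -mchar_lam (_ : mchar _ w * mchar _ w = 1) ?mul1r //.
elim: w => [|g w ih]; first by rewrite !mchar_nil mulr1.
by rewrite !mchar_cons mulrACA ih mulr1 /lam /lamV -qqD subrr expr0z.
Qed.

(** [homogA] constrains collected coefficients only, and a list may contain words that cancel;
    homogeneity is therefore used in this tested form. *)
Definition weighted (kap : GA n -> kf) c p :=
  forall phi, ev (fun w => mchar kap w * phi w) p = c * ev phi p.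

Lemma weighted_lam a p beta : homogA p beta ->
  weighted (lam a) (qi d a.1 (sg a.2 * pairh C a.1 beta)) p.
Proof.
move=> h phi; apply: ev_support => w /h hw; rewrite mchar_lam; congr (qi d _ (_ * _)).
by apply: eq_bigr => j _; rewrite hw.
Qed.

Lemma weighted_lamV a p beta : homogA p beta ->
  weighted (lamV a) (qi d a.1 (- (sg a.2 * pairh C a.1 beta))) p.
Proof.
move=> h phi; apply: ev_support => w /h hw; rewrite mchar_lamV; congr (qi d _ (- (_ * _))).
by apply: eq_bigr => j _; rewrite hw.
Qed.

Lemma weighted_mul kap c1 c2 p q :
  weighted kap c1 p -> weighted kap c2 q -> weighted kap (c1 * c2) (fmul p q).
Proof.
move=> h1 h2 phi; rewrite ev_mul.
under eq_ev => w do under eq_ev => u do rewrite mchar_cat -mulrA.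
under eq_ev => w do rewrite ev_Zl h2.
by rewrite h1 ev_Zl mulrA ev_mul.
Qed.

Lemma pairhD i (b1 b2 : 'I_n -> int) :
  pairh C i (fun j => b1 j + b2 j) = pairh C i b1 + pairh C i b2.
Proof. by rewrite /pairh -big_split; apply: eq_bigr => j _; rewrite mulrDl. Qed.

Lemma generator_mul_left i k X (Y : fpoly 'I_n) (bx by_ : 'I_n -> int) :
  all (fun cw => all (fun g : GA n => k + 1 < g.2) cw.2) X ->
  homogA X bx -> homogA (emb (k + 1) Y) by_ ->
  Aeq (fmul (fgen ((i, k) : GA n)) (fmul X (emb (k + 1) Y)))
   (fscale (qi d i (sg k * pairh C i (fun j => bx j + by_ j)))
     (fadd (fmul (fmul X (emb (k + 1) Y)) (fgen ((i, k) : GA n)))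
        (fscale (cq d i * qi d i (-1)) (fmul X (emb (k + 1) (estar C d i Y)))))).
Proof.
move=> hX homX homY; pose a : GA n := (i, k); pose D := fmul X (emb (k + 1) Y).
apply: (fcongr_trans (q := lin (fun u => word (a :: u)) D)).
  apply: fcongr_feq => phi; rewrite ev_lin ev_mul ev_gen; apply: eq_ev => u.
  by rewrite ev_word mul1r.
apply: (fcongr_trans (q := lin (move_right C d a) D)).
  apply: fcongr_lin => cw /allpairsP[[c1 c2] [/= h1 /mem_emb[v h2] ->]] /=.
  apply: straighten_left => //; first exact: (allP hX _ h1).
  by rewrite h2 all_map; apply/allP => l _ /=.
apply: fcongr_feq => phi; rewrite ev_lin.
under eq_ev => u do rewrite ev_move_right.
rewrite (weighted_mul (weighted_lam a homX) (weighted_lam a homY)).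
rewrite -qiD -mulrDr -pairhD !ev_scale; congr (_ * _).
rewrite ev_Dl ev_Zl ev_add ev_scale; congr (_ + _ * _).
  by rewrite [RHS]ev_mul; apply: eq_ev => u; rewrite ev_gen cats1.
rewrite !ev_mul; apply: eq_ev_in => cw hcw _.
rewrite !ev_emb ev_estar; apply: eq_ev => v.
rewrite dr_cat_out ?dr_embw ?ev_estar_w //.
by apply/negP => /(allP (allP hX _ hcw)) /=; rewrite ltxx.
Qed.

Lemma generator_mul_right i k (Z : fpoly 'I_n) W (bz bw : 'I_n -> int) :
  all (fun cw => all (fun g : GA n => g.2 < k) cw.2) W ->
  homogA (emb k Z) bz -> homogA W bw ->
  Aeq (fmul (fmul (emb k Z) W) (fgen ((i, k + 1) : GA n)))
   (fscale (qi d i (sg (k + 1) * pairh C i (fun j => bz j + bw j)))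
     (fadd (fmul (fgen ((i, k + 1) : GA n)) (fmul (emb k Z) W))
        (fscale (cq d i * qi d i (-1)) (fmul (emb k (eprime C d i Z)) W)))).
Proof.
move=> hW homZ homW; pose a : GA n := (i, k); pose D := fmul (emb k Z) W.
apply: (fcongr_trans (q := lin (fun u => word (rcons u (sh a))) D)).
  apply: fcongr_feq => phi; rewrite ev_lin ev_mul; apply: eq_ev => u.
  by rewrite ev_gen ev_word mul1r cats1.
apply: (fcongr_trans (q := lin (move_left C d a) D)).
  apply: fcongr_lin => cw /allpairsP[[c1 c2] [/= /mem_emb[v h2] h1 ->]] /=.
  apply: straighten_right => //; last exact: (allP hW _ h1).
  by rewrite h2 all_map; apply/allP => l _ /=.
apply: fcongr_feq => phi; rewrite ev_lin.
under eq_ev => u do rewrite ev_move_left.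
rewrite (weighted_mul (weighted_lamV a homZ) (weighted_lamV a homW)).
rewrite -qiD -opprD -mulrDr -pairhD sgS mulNr !ev_scale; congr (_ * _).
rewrite ev_Dl ev_Zl ev_add ev_scale; congr (_ + _ * _).
  by rewrite [RHS]ev_mul ev_gen.
rewrite !ev_mul !ev_emb ev_eprime; apply: eq_ev => v.
rewrite ev_eprime_w -(dl_embw C d (fun u => ev (fun u' => phi (u ++ u')) W) k i v).
rewrite [RHS]exchange_ev; apply: eq_ev_in => cw hcw _.
rewrite dl_cat [X in _ + _ * X]dl_out ?mulr0 ?addr0 //.
by apply/negP => /(allP (allP hW _ hcw)) /=; rewrite ltxx.
Qed.

(* The form of w.1 and u.1 in M. *)
Definition pairM w u : kf :=
  ev (fun x => ev (gfrm x) (act u [:: (1, [::])])) (act w [:: (1, [::])]).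

Definition bform p q : kf := ev (fun w => ev (pairM w) q) p.

Lemma pairMC w u : pairM w u = pairM u w.
Proof.
rewrite /pairM exchange_ev; apply: eq_ev => y; apply: eq_ev => x.
exact: gfrmC.
Qed.

Lemma bformC p q : bform p q = bform q p.
Proof.
by rewrite /bform exchange_ev; apply: eq_ev => u; apply: eq_ev => w; rewrite pairMC.
Qed.

(** The difference of [p] and [p'] is null, hence acts on 1 into the radical of the form. *)
Lemma bform_Aeq p p' q : Aeq p p' -> bform p q = bform p' q.
Proof.
move=> h; apply/eqP; rewrite -subr_eq0 -[_ - _]ev_sub; apply/eqP.
have hn := null_in_ideal sformC Cdiag Coff d_gt0 h.
rewrite -/(bform _ _) bformC /bform -[RHS](ev_0l q); apply: eq_ev => w.
transitivity (ev (fun x => ev (fun u => ev (gfrm x) (act u [:: (1, [::])])) (fsub p p'))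
  (act w [:: (1, [::])])); first by rewrite exchange_ev.
by rewrite -[RHS](ev_0l (act w [:: (1, [::])])); apply: eq_ev => x; apply: hn.
Qed.

Lemma formFE_bform F G : formFE C d F G = bform (evalFE F) (evalFE G).
Proof.
rewrite (formFE_gfrm sformC d_gt0); apply: eq_ev_in => cw /evalFE_sorted hw _.
apply: eq_ev_in => cu /evalFE_sorted hu _.
by rewrite /pairM act_sorted // act_sorted.
Qed.

(** The adjoint E_a of L_a crosses the action of [w] with the scalar [mchar (lam a) w], and sends 1
    to q_i times the letter [sh a]. *)
Lemma pairM_cons w a u :
  pairM w (a :: u) = mchar (lam a) w * qi d a.1 1 * pairM (rcons w (sh a)) u.
Proof.
pose Phi x := ev (gfrm x) (act u [:: (1, [::])]).
have -> : pairM w (a :: u) = ev Phi (lin (Ew a) (act w [:: (1, [::])])).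
  rewrite ev_lin; apply: eq_ev => x; rewrite [act _ _]/= ev_lin exchange_ev.
  by apply: eq_ev => y; rewrite (Lw_adj sformC Cdiag).
rewrite (act_Ew sformC) -mulrA; congr (_ * _).
rewrite ev_act ev_lin ev_word mul1r ev_Ew mchar_nil ev_nil mulr0 add0r mul1r.
congr (_ * _); rewrite /pairM -[rcons w _]cats1 act_cat [RHS]ev_act act_sorted //.
Qed.

Lemma lam_sh_inv c b : lam c b * lam c (sh b) = 1.
Proof. by case: b => j p; apply: lam_adj. Qed.

(* L_b adds the letter b or removes the letter b+1, which has the opposite weight. *)
Lemma act_weight c phi w : ev (fun v => mchar (lam c) v * phi v) (act w [:: (1, [::])]) =
  mchar (lam c) w * ev phi (act w [:: (1, [::])]).
Proof.
elim: w phi => [|b w ih] phi; first by rewrite !ev_word mchar_nil !mul1r.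
rewrite [act _ _]/= !ev_lin mchar_cons -[RHS]mulrA -ih -ev_Zl; apply: eq_ev => v.
rewrite !ev_Lw mchar_cons.
have := dr_mchar chiA (lam c) phi (sh b) v.
set S := ev _ _ => h; rewrite -[S]mulr1 -(lam_sh_inv c b).
transitivity (mchar (theta C d b) v * (lam c b * mchar (lam c) v * phi (b :: v) +
   cq d b.1 * qi d b.1 (-1) * (lam c b * (S * lam c (sh b))))); first by ring.
by rewrite h; ring.
Qed.

Lemma pairM_weight c w u : mchar (lam c) w * pairM w u = mchar (lam c) u * pairM w u.
Proof.
rewrite -[LHS]act_weight /pairM -[RHS]ev_Zl; apply: eq_ev => x.
rewrite -ev_Zl -act_weight; apply: eq_ev => y.
by rewrite /gfrm frm_mchar.
Qed.

(** By symmetry this is [pairM_cons] with the character moved to the other argument; there [sh a]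
    counts for q_i^2, which changes q_i into q_i^-1. *)
Lemma pairM_cons_left w a u :
  pairM (a :: w) u = mchar (lam a) w * qi d a.1 (-1) * pairM w (rcons u (sh a)).
Proof.
rewrite pairMC pairM_cons pairMC.
have := pairM_weight a w (rcons u (sh a)); rewrite mchar_rcons.
have -> : lam a (sh a) = qi d a.1 2 by case: (a) => i k; rewrite lam_slot Cdiag.
have -> : qi d a.1 1 = qi d a.1 (-1) * qi d a.1 2 by rewrite -qiD.
move=> h; rewrite [RHS]mulrAC h; ring.
Qed.

Lemma bform_genl a c p q : weighted (lam a) c p ->
  bform p (fmul (fgen a) q) = c * qi d a.1 1 * bform (fmul p (fgen (sh a))) q.
Proof.
move=> h; rewrite /bform ev_mul -mulrA -ev_Zl -h; apply: eq_ev => w.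
rewrite ev_mul ev_gen -!ev_Zl; under eq_ev => u do rewrite pairM_cons.
by rewrite ev_gen cats1 -!ev_Zl; apply: eq_ev => u; rewrite mulrA.
Qed.

Lemma bform_genr a c p q : weighted (lam a) c p ->
  bform (fmul (fgen a) p) q = c * qi d a.1 (-1) * bform p (fmul q (fgen (sh a))).
Proof.
move=> h; rewrite /bform ev_mul ev_gen -mulrA -ev_Zl -h; apply: eq_ev => w.
rewrite ev_mul -!ev_Zl; apply: eq_ev => u.
by rewrite ev_gen cats1 pairM_cons_left mulrA.
Qed.
End Form.

(** * Assembly of the four formulas *)

Theorem theorem6p4 (n : nat) (C : 'M[int]_n) (d : 'I_n -> nat) (i : 'I_n) (k : int)
    (X W : fpoly (GA n)) (Y Z : fpoly 'I_n) (bx by_ bz bw : 'I_n -> int) :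
  finite_cartan C d ->
  all (fun cw => all (fun g : GA n => k + 1 < g.2) cw.2) X ->
  all (fun cw => all (fun g : GA n => g.2 < k) cw.2) W ->
  homogA X bx -> homogA (emb (k + 1) Y) by_ -> homogA (emb k Z) bz -> homogA W bw ->
  let x := X in let y := emb (k + 1) Y in let z := emb k Z in let w := W in
  let P := fmul x (fmul y (fmul z w)) in
  let fk := fgen ((i, k) : GA n) in
  let fk1 := fgen ((i, k + 1) : GA n) in
  let c := qi d i (-1) - qi d i 1 in
  (* (q_i^{-1}-q_i) x e*_i(y) z w + q_i x y (f_{i,k} z) w *)
  let S1 := fadd (fscale c (fmul x (fmul (emb (k + 1) (estar C d i Y)) (fmul z w))))
                 (fscale (qi d i 1) (fmul x (fmul y (fmul (fmul fk z) w)))) in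
  (* (q_i^{-1}-q_i) x y e'_i(z) w + q_i x (y f_{i,k+1}) z w *)
  let S2 := fadd (fscale c (fmul x (fmul y (fmul (emb k (eprime C d i Z)) w))))
                 (fscale (qi d i 1) (fmul x (fmul (fmul y fk1) (fmul z w)))) in
  let exy := (-1) ^+ absz k * pairh C i (fun j => bx j + by_ j) in
  let ezw := (-1) ^+ absz (k + 1) * pairh C i (fun j => bz j + bw j) in
  [/\ (* (i) *)
      Aeq C d (fmul fk P) (fscale (qi d i (exy - 1)) S1),
      (* (ii) E'_{i,k}(P) = q_i^{exy} S2, i.e. ((q_i^{exy} S2, v)) = ((P, f_{i,k} v)) *)
      (forall F1 F2 G1 G2 : seq (fterm n),
         Aeq C d (evalFE F1) P ->
         Aeq C d (evalFE F2) (fscale (qi d i exy) S2) ->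
         Aeq C d (evalFE G1) (fmul fk (evalFE G2)) ->
         formFE C d F2 G2 = formFE C d F1 G1),
      (* (iii) *)
      Aeq C d (fmul P fk1) (fscale (qi d i (ezw - 1)) S2)
    & (* (iv) E*_{i,k+1}(P) = q_i^{ezw} S1, i.e. ((q_i^{ezw} S1, v)) = ((P, v f_{i,k+1})) *)
      (forall F1 F2 G1 G2 : seq (fterm n),
         Aeq C d (evalFE F1) P ->
         Aeq C d (evalFE F2) (fscale (qi d i ezw) S1) ->
         Aeq C d (evalFE G1) (fmul (evalFE G2) fk1) ->
         formFE C d F2 G2 = formFE C d F1 G1)].
Proof.
move=> [Cdiag Coff [d_gt0 _] symC _] hX hW homX homY homZ homW /=.
set P := fmul X _; set fk := fgen _; set fk1 := fgen _; set S1 := fadd _ _.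
set S2 := fadd _ _; set exy := _ * pairh C i _; set ezw := _ * pairh C i _.
have sformC : forall i j, sform C d i j = sform C d j i := symC.
pose a : GA n := (i, k).
have part1 : Aeq C d (fmul fk P) (fscale (qi d i (exy - 1)) S1).
  apply: (fcongr_trans (q := fmul (fmul fk (fmul X (emb (k + 1) Y))) (fmul (emb k Z) W))).
    apply: fcongr_feq => phi; rewrite ev_mulA; apply: feq_mul => // phi'.
    by rewrite ev_mulA.
  apply: fcongr_trans (fcongr_mulr _ (generator_mul_left d Cdiag i hX homX homY)) _.
  apply: fcongr_feq => phi.
  rewrite ev_mulZl ev_mulDl ev_mulZl !ev_mulA ev_scale ev_add !ev_scale -/exy.
  have -> : ev phi (fmul X (fmul (emb (k + 1) Y) (fmul (fmul fk (emb k Z)) W))) =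
      ev phi (fmul X (fmul (emb (k + 1) Y) (fmul fk (fmul (emb k Z) W)))).
    by apply: feq_mul => // phi1; apply: feq_mul => // phi2; rewrite ev_mulA.
  rewrite -[exy in LHS](subrK 1) qiD /cq.
  have := qiV d i 1; move: (qi d i 1) (qi d i (-1)) (qi d i (exy - 1)) => q r e h.
  rewrite -/fk; move: (ev phi _) (ev phi _) => e1 e2.
  transitivity (e * q * e2 + e * (q * r) * (r - q) * e1); first by ring.
  by rewrite h; ring.
have part3 : Aeq C d (fmul P fk1) (fscale (qi d i (ezw - 1)) S2).
  apply: (fcongr_trans (q := fmul (fmul X (emb (k + 1) Y)) (fmul (fmul (emb k Z) W) fk1))).
    apply: fcongr_feq => phi; rewrite !ev_mulA; apply: feq_mul => // phi1.
    by rewrite ev_mulA; apply: feq_mul.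
  apply: fcongr_trans (fcongr_mull _ (generator_mul_right sformC Cdiag i hW homZ homW)) _.
  apply: fcongr_feq => phi.
  rewrite ev_mulZr ev_mulDr ev_mulZr !ev_mulA ev_scale ev_add !ev_scale -/ezw.
  have -> : ev phi (fmul X (fmul (fmul (emb (k + 1) Y) fk1) (fmul (emb k Z) W))) =
      ev phi (fmul X (fmul (emb (k + 1) Y) (fmul fk1 (fmul (emb k Z) W)))).
    by apply: feq_mul => // phi1; rewrite ev_mulA.
  rewrite -[ezw in LHS](subrK 1) qiD /cq.
  have := qiV d i 1; move: (qi d i 1) (qi d i (-1)) (qi d i (ezw - 1)) => q r e h.
  rewrite -/fk1; move: (ev phi _) (ev phi _) => e1 e2.
  transitivity (e * q * e2 + e * (q * r) * (r - q) * e1); first by ring.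
  by rewrite h; ring.
(* Since [ezw] carries the sign (-1)^(k+1), the exponent (-1)^k <h_i, wt(P)> equals [exy - ezw]. *)
have wP : weighted (lam C d a) (qi d i (exy - ezw)) P.
  have -> : qi d i (exy - ezw) = qi d i (sg k * pairh C i bx) * (qi d i (sg k * pairh C i by_) *
      (qi d i (sg k * pairh C i bz) * qi d i (sg k * pairh C i bw))).
    rewrite -!qiD; congr (qi d i _).
    by rewrite /exy /ezw -!/(sg _) sgS !pairhD; ring.
  apply: (weighted_mul (weighted_lam C d a homX)).
  apply: (weighted_mul (weighted_lam C d a homY)).
  exact: (weighted_mul (weighted_lam C d a homZ) (weighted_lam C d a homW)).
have bZ c p q : bform C d (fscale c p) q = c * bform C d p q by apply: ev_scale.
have bE p p' q : Aeq C d p p' -> bform C d p q = bform C d p' q.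
  exact: (bform_Aeq sformC Cdiag Coff d_gt0).
split=> // F1 F2 G1 G2 h1 h2 h3; rewrite !(formFE_bform sformC d_gt0).
  rewrite (bE _ _ _ h2) (bE _ _ _ h1) [RHS](bformC sformC) (bE _ _ _ h3) [RHS](bformC sformC).
  (* Pairing P with f_{i,k} v is pairing P f_{i,k+1} with v, up to a scalar; with (iii) the
     exponents add up as (exy - ezw) + 1 + (ezw - 1) = exy. *)
  rewrite (bform_genl sformC Cdiag _ wP) bZ (bE _ _ _ part3) bZ mulrA; congr (_ * _).
  by rewrite -!qiD; congr (qi d i _); ring.
rewrite (bE _ _ _ h2) (bE _ _ _ h1) [RHS](bformC sformC) (bE _ _ _ h3) [RHS](bformC sformC).
(* Read backwards: the pairing of f_{i,k} P with v, computed by (i), determines that of P with v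
   f_{i,k+1}. *)
have := bform_genr sformC Cdiag (evalFE G2) wP; rewrite (bE _ _ _ part1) !bZ => h.
have -> : qi d i ezw = qi d i (ezw - exy + 1) * qi d i (exy - 1).
  by rewrite -qiD; congr (qi d i _); ring.
rewrite -mulrA h mulrA -!qiD -[RHS]mul1r -(qi0 d i); congr (qi d i _ * _).
by ring.
Qed.
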